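(* There is a deterministic algorithm which, given $n$, a vector $\mathbf{a}=(a_1,\dots,a_n)\in\mathbb{Z}_{\ge 0}^n$ and $\epsilon$ with $0<\epsilon<1$, outputs a value $\widehat V$ satisfying $$(1-\epsilon)\,\mathrm{Vol}(P_{\mathbf{a}})\le \widehat V\le (1+\epsilon)\,\mathrm{Vol}(P_{\mathbf{a}})$$ and runs in $O(n^{10}\epsilon^{-6})$ time.
   Context: $\mathbf{e}_1,\dots,\mathbf{e}_n$ denote the standard basis vectors of $\mathbb{R}^n$. The knapsack dual polytope is $P_{\mathbf{a}}=\mathrm{conv}\{\pm\mathbf{e}_1,\dots,\pm\mathbf{e}_n,\mathbf{a}\}\subseteq\mathbb{R}^n$. $\mathrm{Vol}$ denotes $n$-dimensional Lebesgue measure. *)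

(* Defs.v *)
From HB Require Import structures.
From mathcomp Require Import all_boot all_order all_algebra.
From mathcomp Require Import all_classical all_reals all_analysis.
Set Implicit Arguments. Unset Strict Implicit. Unset Printing Implicit Defensive.
Import Order.TTheory GRing.Theory Num.Theory.
Local Open Scope classical_set_scope.
Local Open Scope ring_scope.

Definition basis_vec (R : realType) (n : nat) (i : 'I_n) : n.-tuple R :=
  [tuple (if j == i then 1 else 0) | j < n].

Definition opp_vec (R : realType) (n : nat) (x : n.-tuple R) : n.-tuple R :=
  [tuple - tnth x j | j < n].

Definition conv (R : realType) (n : nat) (pts : seq (n.-tuple R)) :
    set (n.-tuple R) :=
  [set x | exists w : 'I_(size pts) -> R,
      (forall k, 0 <= w k) /\ \sum_k w k = 1 /\
      forall j : 'I_n,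
        tnth x j = \sum_k w k * tnth (nth x pts k) j].

Definition knapsack_dual_polytope (R : realType) (n : nat) (a : n.-tuple nat) :
    set (n.-tuple R) :=
  conv ([seq basis_vec R i | i <- enum 'I_n] ++
        [seq opp_vec (basis_vec R i) | i <- enum 'I_n] ++
        [:: [tuple (tnth a j)%:R | j < n]]).

(* n-dimensional Lebesgue measure on n.-tuple R, defined by iterated
   integration of one-dimensional Lebesgue measure (Cavalieri/Tonelli). *)
Fixpoint vol (R : realType) (n : nat) : set (n.-tuple R) -> \bar R :=
  match n with
  | 0 => fun A => if `[< A [tuple] >] then 1%E else 0%E
  | m.+1 => fun A =>
      (\int[@lebesgue_measure R]_x vol [set t : m.-tuple R | A (cons_tuple x t)])%E
  end.

(* Model of computation: a deterministic unit-cost RAM over the rationals   *)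
(* (real-RAM style: registers hold rationals, arithmetic +,-,*,/ and         *)
(* comparisons cost one step; no floor operation).                          *)

Inductive instr :=
| IConst of nat & rat           (* M[d] := c                            *)
| IAdd of nat & nat & nat       (* M[d] := M[x] + M[y]                  *)
| ISub of nat & nat & nat       (* M[d] := M[x] - M[y]                  *)
| IMul of nat & nat & nat       (* M[d] := M[x] * M[y]                  *)
| IDiv of nat & nat & nat       (* M[d] := M[x] / M[y]  (crash if M[y]=0) *)
| ILoad of nat & nat            (* M[d] := M[M[x]]  (indirect read)      *)
| IStore of nat & nat           (* M[M[d]] := M[x]  (indirect write)     *)
| IJpos of nat & nat            (* if M[r] > 0 then goto l               *)
| IJzero of nat & nat           (* if M[r] = 0 then goto l               *)
| IJmp of nat                   (* goto l                                *)
| IHalt.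

Definition memory := nat -> rat.
Definition config := (nat * memory)%type.

Definition addr (q : rat) : option nat :=
  if (denq q == 1%Z) && (0 <= numq q)%R then Some (absz (numq q)) else None.

Definition upd (m : memory) (d : nat) (v : rat) : memory :=
  fun i => if i == d then v else m i.

(* instruction fetch; running off the program is a halt *)
Definition fetch (p : seq instr) (pc : nat) : instr := nth IHalt p pc.

Definition step (p : seq instr) (c : config) : option config :=
  let: (pc, m) := c in
  match fetch p pc with
  | IConst d v => Some (pc.+1, upd m d v)
  | IAdd d x y => Some (pc.+1, upd m d (m x + m y))
  | ISub d x y => Some (pc.+1, upd m d (m x - m y))
  | IMul d x y => Some (pc.+1, upd m d (m x * m y))
  | IDiv d x y => if m y == 0 then None else Some (pc.+1, upd m d (m x / m y))
  | ILoad d x => match addr (m x) with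
                 | Some k => Some (pc.+1, upd m d (m k))
                 | None => None end
  | IStore d x => match addr (m d) with
                  | Some k => Some (pc.+1, upd m k (m x))
                  | None => None end
  | IJpos r l => Some (if 0 < m r then l else pc.+1, m)
  | IJzero r l => Some (if m r == 0 then l else pc.+1, m)
  | IJmp l => Some (l, m)
  | IHalt => None
  end.

Fixpoint halts_in (p : seq instr) (t : nat) (c : config) (m : memory) : Prop :=
  match t with
  | 0 => fetch p c.1 = IHalt /\ c.2 = m
  | t'.+1 => exists c', step p c = Some c' /\ halts_in p t' c' m
  end.

Definition init_mem (n : nat) (a : n.-tuple nat) (eps : rat) : memory :=
  fun i => if i == 0%N then n%:R
           else if i == 1%N then eps
           else if (i - 2 < n)%N then (nth 0%N a (i - 2))%:R else 0.

(* Main.v *)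
Require Import Defs.
From HB Require Import structures.
From mathcomp Require Import all_boot all_order all_algebra.
From mathcomp Require Import all_classical all_reals all_analysis.
From mathcomp Require Import measurable_realfun.
From mathcomp Require Import ring lra zify.
Import Order.TTheory GRing.Theory Num.Theory.
Import numFieldNormedType.Exports.
Set Implicit Arguments. Unset Strict Implicit. Unset Printing Implicit Defensive.
Local Open Scope classical_set_scope.
Local Open Scope ring_scope.

(** [P_a] is the union over [t] in [0, 1] of the cross-polytopes of radius
    [1 - t] centred at [t a].  While [t] grows, the facet with sign vector
    [sigma] moves outwards at speed [sigma . a - 1] as long as this is positive,
    so [n! Vol(P_a)] is the sum over all [sigma] of [max(1, sigma . a)].  The
    same sweeping formula holds for every coordinate section of [P_a], where the
    radius [1 - t] becomes a concave piecewise linear function of [t]; it is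
    proved by induction on the number of free coordinates, the one-dimensional
    case being the length of an interval and the induction step being Tonelli's
    theorem for one coordinate and [t].

    The sum over [sigma] is [1]-Lipschitz per sign vector and at least
    [2^n (1 + sum a) / (2 (n + 1))].  Rounding every [a_i] up to a multiple of
    [delta = eps (1 + sum a) / (4 (n + 1)^2)] therefore costs a factor of at
    most [1 + eps], and makes the sum computable by a knapsack-type dynamic
    program over [O(n^3 / eps)] cells. *)

(** [vol] is an iterated integral, so an induction on the dimension has to treat coordinate
    sections, and a section of [P_a] need not be the hull of a cross-polytope and a point. The
    unions over [t] are closed under sections: fixing coordinate [i] at [c] merely lowers the radius
    at time [t] by [|c - t a_i|]. Since [max(1, x) = 1 + max(0, x - 1)], the sum over [sigma] splits
    into [2^n] for the cross-polytope at time 0 and a sum of positive parts for what is swept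
    afterwards.

    For the algorithm, [sigma . a] is written as twice a subset sum minus [sum a]. Only the subset
    sum is rounded while [sum a] stays exact, so the rounded value never falls below the true one.
    The denominator [4 (n + 1)^2] is the product of [2 (n + 1)], which covers an error of [2 delta]
    for each entry, and of the [2 (n + 1)] in the lower bound. The [1] in [1 + sum a] keeps [delta]
    positive for the zero vector. *)

(** * The volume of the knapsack dual polytope *)

(* The sum of [max 0 (z + sigma . l)] over all sign vectors [sigma]. *)
Fixpoint signed_pos_sum (K : realDomainType) (l : seq K) (z : K) : K :=
  if l is b :: l' then signed_pos_sum l' (z + b) + signed_pos_sum l' (z - b)
  else Num.max 0 z.

Lemma signed_pos_sum_ge0 (K : realDomainType) (l : seq K) z :
  0 <= signed_pos_sum l z.
Proof.
elim: l z => [|b l IH] z /=; first by rewrite le_max lexx.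
exact: addr_ge0.
Qed.

Section Volume.
Context {R : realType}.
Implicit Types (s : seq (R * R)) (t r c a b u : R) (l : seq R) (m k : nat).
Local Notation mu := (@lebesgue_measure R).

(* At [0] any value in [-1, 1] would do: [slope] only has to be a supergradient
   of [slack]. *)
Definition pm1 u : R := if 0 < u then 1 else -1.

(** The volume of the [k]-dimensional simplex of all [x >= 0] with coordinate sum at most [r]; a
    cross-polytope of radius [r] consists of [2 ^ k] copies. For [k = 0] the sign test makes this
    the indicator of a nonempty body. *)
Definition truncpow k r : R := if 0 <= r then r ^+ k / k`!%:R else 0.

(* [s] lists the coordinates already fixed, each as a pair (value, entry of the
   vector [a]); [slack s t] is the radius left at time [t] for the free ones. *)
Fixpoint slack s t : R :=
  if s is (c, a) :: s' then slack s' t - `|c - t * a| else 1 - t.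

Fixpoint slope s t : R :=
  if s is (c, a) :: s' then slope s' t + a * pm1 (c - t * a) else -1.

(* The rate at which the facets of a [k.+1]-dimensional section sweep out new
   volume at time [t]. *)
Definition sweep l s k t : R :=
  if 0 <= t <= 1 then signed_pos_sum l (slope s t) * truncpow k (slack s t)
  else 0.

Lemma truncpow_ge0 k r : 0 <= truncpow k r.
Proof.
rewrite /truncpow; case: ifPn => // r0.
by rewrite divr_ge0 ?exprn_ge0// ler0n.
Qed.

Lemma sweep_ge0 l s k t : 0 <= sweep l s k t.
Proof.
rewrite /sweep; case: ifPn => // _.
by rewrite mulr_ge0 ?signed_pos_sum_ge0 ?truncpow_ge0.
Qed.

Section Measurability.
Context d (T : measurableType d).
Implicit Types f h : T -> R.

Lemma measurable_pm1 f : measurable_fun setT f -> measurable_fun setT (pm1 \o f).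
Proof.
move=> mf; apply: measurable_fun_ifT => //.
exact: measurable_fun_ltr.
Qed.

Lemma measurable_truncpow k f :
  measurable_fun setT f -> measurable_fun setT (truncpow k \o f).
Proof.
move=> mf; apply: measurable_fun_ifT => //.
  exact: measurable_fun_ler.
by apply: measurable_funM => //; exact: measurable_funX.
Qed.

Lemma measurable_signed_pos_sum l f :
  measurable_fun setT f -> measurable_fun setT (signed_pos_sum l \o f).
Proof.
elim: l f => [|b l IH] f mf /=; first exact: measurable_maxr.
apply: measurable_funD.
  by apply: (IH (fun x => f x + b)); exact: measurable_funD.
by apply: (IH (fun x => f x - b)); exact: measurable_funB.
Qed.

Lemma measurable_slack s f :
  measurable_fun setT f -> measurable_fun setT (slack s \o f).
Proof.
move=> mf; elim: s => [|[c a] s IH] /=; first exact: measurable_funB.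
apply: measurable_funB => //.
apply: measurableT_comp => //; apply: measurable_funB => //.
exact: measurable_funM.
Qed.

Lemma measurable_slope s f :
  measurable_fun setT f -> measurable_fun setT (slope s \o f).
Proof.
move=> mf; elim: s => [|[c a] s IH] /=; first exact: measurable_cst.
apply: (measurable_funD IH); apply: (@measurable_funM _ _ _ _ (cst a)) => //.
apply: (measurable_pm1 (f := fun x => c - f x * a)).
by apply: measurable_funB => //; exact: measurable_funM.
Qed.

End Measurability.

(** Measurability is joint in the new coordinate and the time, as Tonelli's theorem requires. *)
Lemma measurable_sweep_cons l s k b :
  measurable_fun setT (fun z : R * R => sweep l ((z.1, b) :: s) k z.2).
Proof.
have m1 : measurable_fun setT (fun z : R * R => z.1) by exact: measurable_fst.
have m2 : measurable_fun setT (fun z : R * R => z.2) by exact: measurable_snd.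
have m12 : measurable_fun setT (fun z : R * R => z.1 - z.2 * b).
  by apply: measurable_funB => //; exact: measurable_funM.
apply: measurable_fun_ifT => //=.
  by apply: measurable_and; exact: measurable_fun_ler.
apply: measurable_funM.
  apply: (@measurable_signed_pos_sum _ _ l
    (fun z : R * R => slope s z.2 + b * pm1 (z.1 - z.2 * b))).
  apply: measurable_funD; first exact: measurable_slope.
  by apply: measurable_funM => //; exact: measurable_pm1 m12.
apply: (@measurable_truncpow _ _ k (fun z : R * R => slack s z.2 - `|z.1 - z.2 * b|)).
apply: measurable_funB; first exact: measurable_slack.
exact: measurableT_comp.
Qed.

(** * One-dimensional integrals of truncated powers *)

Lemma ge0_integral_shift (f : R -> \bar R) c :
  measurable_fun setT f -> (forall x, 0 <= f x)%E ->
  (\int[mu]_x f (x + c)%R = \int[mu]_x f x)%E.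
Proof.
move=> mf f0.
have mphi : measurable_fun setT
    ((fun x => x + c) : measurableTypeR R -> measurableTypeR R).
  exact: measurable_funD.
have /= := @ge0_integral_pushforward _ _ _ _ R _ mphi mu setT f measurableT mf
  (fun x _ => f0 x).
rewrite preimage_setT => <-.
apply: eq_measure_integral => //= A mA _.
(* The translated measure agrees with Lebesgue measure on half-open intervals, hence everywhere. *)
apply/esym/lebesgue_measure_unique => //= _ [[x y] _ <-].
rewrite /pushforward /= [X in _ = mu X](_ : _ = `]x - c, y - c]%classic); last first.
  by apply/seteqP; split=> z /=; rewrite !in_itv/= ltrBlDr lerBrDr.
rewrite !lebesgue_measure_itv/= !lte_fin ltrD2r; case: ifP => // _.
by rewrite -!EFinD; congr (_%:E); lra.
Qed.

Lemma integral_pow_segment k r : 0 < r ->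
  (\int[mu]_(u in `[0%R, r]) ((r - u) ^+ k / k`!%:R)%R%:E
    = (r ^+ k.+1 / k.+1`!%:R)%:E)%E.
Proof.
move=> r0.
(* The antiderivative is taken as a polynomial, so that its derivative is computed algebraically. *)
pose p : {poly R} := - (k.+1`!%:R^-1 *: (r%:P - 'X) ^+ k.+1).
pose q : {poly R} := k`!%:R^-1 *: (r%:P - 'X) ^+ k.
have pq : p^`() = q.
  rewrite /p derivN derivZ deriv_exp derivB derivC derivX sub0r/= mulN1r.
  rewrite mulNrn scalerN opprK -scalerMnr scalerMnl /q.
  by rewrite factS natrM invfM -mulr_natr mulrAC mulVf ?mul1r// pnatr_eq0.
have qE u : (r - u) ^+ k / k`!%:R = q.[u].
  by rewrite /q !hornerE mulrC.
under eq_integral do rewrite qE.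
rewrite (@continuous_FTC2 _ _ (horner p)) //.
- rewrite /p !hornerE subrr expr0n/= mulr0 oppr0.
  by rewrite addr0 opprK add0e mulrC.
- by apply: continuous_subspaceT => x; exact: continuous_horner.
- split.
  + by move=> x _; exact: derivable_horner.
  + by apply: cvg_at_right_filter; exact: continuous_horner.
  + by apply: cvg_at_left_filter; exact: continuous_horner.
- by move=> x _; rewrite -pq derivE.
Qed.

Lemma integral_truncpow_pos k r :
  (\int[mu]_(u in `[0%R, +oo[) (truncpow k (r - u))%:E
    = (truncpow k.+1 r)%:E)%E.
Proof.
have [r0|r0] := ltP r 0.
  rewrite integral0_eq ?/truncpow ?leNgt ?r0// => x /=.
  by rewrite in_itv/= andbT => x0; rewrite ifN// -ltNge; lra.
transitivity (\int[mu]_(u in `[0%R, r]) ((r - u) ^+ k / k`!%:R)%:E)%E.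
  rewrite integral_mkcond [RHS]integral_mkcond; apply: eq_integral => x _.
  rewrite /patch; case: ifPn; rewrite ?notin_setE ?inE/= in_itv/= ?andbT.
    move=> x0; case: ifPn; rewrite ?notin_setE ?inE/= in_itv/= x0/= => xr.
      by rewrite /truncpow subr_ge0 xr.
    by rewrite /truncpow subr_ge0 (negbTE (introN idP xr)).
  move=> /negP x0; case: ifPn => //; rewrite inE/= in_itv/= => /andP[xx].
  by rewrite xx in x0.
move: r0; rewrite le_eqVlt => /predU1P[<-|r0].
  by rewrite set_itv1 integral_set1 /truncpow lexx expr0n/= mul0r.
by rewrite integral_pow_segment// /truncpow ltW.
Qed.

(** [A] and [B] stand for the sums over the sign vectors that give the new coordinate the sign plus
    or minus. Integrating over a half-line turns the simplex into one of the next dimension. *)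
Lemma integral_truncpow_pm1 k r (A B : R) : 0 <= A -> 0 <= B ->
  (\int[mu]_u ((if (0 < u)%R then A else B) * truncpow k (r - `|u|))%:E
    = ((A + B) * truncpow k.+1 r)%:E)%E.
Proof.
move=> A0 B0.
have mn : measurable_fun setT (fun u : R => r - `|u|).
  by apply: measurable_funB => //; exact: measurableT_comp.
have mt : measurable_fun setT (fun u : R => truncpow k (r - `|u|)).
  exact: measurable_truncpow mn.
have mf : measurable_fun setT (fun u : R => (if 0 < u then A else B) * truncpow k (r - `|u|)).
  apply: measurable_funM => //; apply: measurable_fun_ifT => //.
  exact: measurable_fun_ltr.
have f0 (u : R) : (0 <= ((if (0 < u)%R then A else B) * truncpow k (r - `|u|))%:E)%E.
  by rewrite lee_fin mulr_ge0 ?truncpow_ge0//; case: ifP.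
have half : (\int[mu]_(u in `[0%R, +oo[) (truncpow k (r - `|u|))%:E
    = (truncpow k.+1 r)%:E)%E.
  rewrite -integral_truncpow_pos; apply: eq_integral => u.
  by rewrite inE/= in_itv/= andbT => u0; rewrite ger0_norm.
rewrite -[in LHS](@setUv _ `]0%R, +oo[%classic) ge0_integral_setU//=; last 3 first.
- exact: measurableC.
- by rewrite setUv; exact/measurable_EFinP.
- exact/disj_setPCl.
rewrite setCitvr/= mulrDl EFinD; congr (_ + _)%E.
  transitivity (\int[mu]_(u in `]0%R, +oo[) (A%:E * (truncpow k (r - `|u|))%:E))%E.
    apply: eq_integral => u; rewrite inE/= in_itv/= andbT => u0.
    by rewrite u0 EFinM.
  rewrite integral_itv_obnd_cbnd; last first.
    by apply/measurable_EFinP/measurable_funTS; apply: measurable_funM.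
  rewrite ge0_integralZl ?half ?EFinM//.
    by apply/measurable_EFinP/measurable_funTS.
  by move=> u _; rewrite lee_fin truncpow_ge0.
transitivity (\int[mu]_(u in `]-oo, 0%R]) (B%:E * (truncpow k (r - `|(- u)%R|))%:E))%E.
  apply: eq_integral => u; rewrite inE/= in_itv/= => u0.
  by rewrite ltNge u0/= normrN EFinM.
rewrite -(@ge0_integration_by_substitution0 _ (fun u => B%:E * (truncpow k (r - `|u|))%:E)%E).
- rewrite ge0_integralZl ?half ?EFinM//.
    by apply/measurable_EFinP/measurable_funTS.
  by move=> u _; rewrite lee_fin truncpow_ge0.
- by apply/measurable_EFinP; apply: measurable_funM.
- by move=> u; rewrite mule_ge0// lee_fin truncpow_ge0.
Qed.

(** * Concavity of the slack, and the slack as the integral of its slope *)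

Lemma slack_le_slope s t u : slack s u <= slack s t + slope s t * (u - t).
Proof.
elim: s => [|[c a] s IH] /=; first by lra.
(* Each [-|c - x * a|] is the minimum of two affine functions of [x], and [pm1] selects one that
   attains it at [t]. *)
suff : `|c - t * a| - a * pm1 (c - t * a) * (u - t) <= `|c - u * a| by lra.
rewrite /pm1; case: ifPn => h.
  by rewrite gtr0_norm//; apply: le_trans _ (ler_norm _); lra.
rewrite -leNgt in h; rewrite ler0_norm// -(normrN (c - u * a)).
by apply: le_trans _ (ler_norm _); lra.
Qed.

Lemma integrable_pm1 c a t u :
  mu.-integrable `[t, u] (EFin \o (fun x => a * pm1 (c - x * a))).
Proof.
apply: measurable_bounded_integrable => //.
- by rewrite /= lebesgue_measure_itv; case: ifP; rewrite ?ltry.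
- apply: measurable_funTS.
  have mc : measurable_fun setT (fun x : R => c - x * a).
    by apply: measurable_funB => //; exact: measurable_funM.
  exact: measurable_funM (measurable_cst a) (measurable_pm1 mc).
exists `|a|; split => // M aM x _ /=; apply/ltW; apply: le_lt_trans aM.
rewrite normrM -[leRHS]mulr1 ler_wpM2l// /pm1.
by case: ifP; rewrite ?normrN1 ?normr1.
Qed.

Lemma Rintegral_cst_segment (B : bool) t u r : t <= u ->
  \int[mu]_(_ in [set` Interval (BLeft t) (BSide B u)]) r = r * (u - t).
Proof.
move=> tu; rewrite Rintegral_cst//; congr (_ * _).
transitivity (fine (if (t%:E < u%:E)%E then (u%:E - t%:E)%E else 0%E)).
  by congr fine; exact: lebesgue_measure_itv.
rewrite lte_fin.
by move: tu; rewrite le_eqVlt => /predU1P[->|->//]; rewrite ltxx subrr.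
Qed.

Lemma integral_pm1_pos c a t u : 0 <= a -> t <= u -> 0 <= c - u * a ->
  \int[mu]_(x in `[t, u]) (a * pm1 (c - x * a)) = a * (u - t).
Proof.
move=> a0 tu ca.
(* The argument of [pm1] may vanish at [u], where [pm1] is -1, so the right endpoint is dropped. *)
rewrite -Rintegral_itv_bndo_bndc; last first.
  by apply: integrableS (integrable_pm1 c a t u) => //; apply: subset_itvl; rewrite bnd_simp.
transitivity (\int[mu]_(x in `[t, u[) a); last exact: Rintegral_cst_segment.
apply: eq_Rintegral => x; rewrite inE/= in_itv/= => /andP[_ xu].
move: a0; rewrite le_eqVlt => /predU1P[<-|a0]; first by rewrite mul0r.
by rewrite /pm1 ifT ?mulr1//; apply: le_lt_trans ca _; rewrite ltrD2l ltrN2 ltr_pM2r.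
Qed.

Lemma integral_pm1_neg c a t u : 0 <= a -> t <= u -> c - t * a <= 0 ->
  \int[mu]_(x in `[t, u]) (a * pm1 (c - x * a)) = - (a * (u - t)).
Proof.
move=> a0 tu ca.
transitivity (\int[mu]_(x in `[t, u]) (- a)); last by rewrite Rintegral_cst_segment// mulNr.
apply: eq_Rintegral => x; rewrite inE/= in_itv/= => /andP[tx _].
rewrite /pm1 ifN ?mulrN1// -leNgt; apply: le_trans ca.
by rewrite lerD2l lerN2 ler_wpM2r.
Qed.

(** As [a >= 0], the term [c - x * a] changes sign at most once; the remaining case splits at the
    kink [c / a]. *)
Lemma integral_pm1 c a t u : 0 <= a -> t <= u ->
  \int[mu]_(x in `[t, u]) (a * pm1 (c - x * a)) = `|c - t * a| - `|c - u * a|.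
Proof.
move=> a0 tu; have tua : t * a <= u * a by rewrite ler_wpM2r.
have [cu|cu] := leP 0 (c - u * a).
  by rewrite integral_pm1_pos// !ger0_norm//; lra.
have [ct|ct] := leP (c - t * a) 0.
  by rewrite integral_pm1_neg// !ler0_norm//; lra.
have {}a0 : 0 < a.
  by rewrite lt_neqAle a0 andbT; apply/eqP => a00; move: cu ct; rewrite -a00; lra.
pose p := c / a; have pa : p * a = c by rewrite /p mulfVK// gt_eqF.
have tp : t <= p by rewrite /p ler_pdivlMr//; lra.
have pu : p <= u by rewrite /p ler_pdivrMr//; lra.
have := @Rintegral_itvB _ (fun x => a * pm1 (c - x * a)) (BLeft t) (BRight u) p
  (integrable_pm1 c a t u) (ltac:(by rewrite bnd_simp)) (ltac:(by rewrite bnd_simp)).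
rewrite Rintegral_itv_obnd_cbnd; last first.
  by apply: integrableS (integrable_pm1 c a p u) => //; apply: subset_itvr; rewrite bnd_simp.
have := @integral_pm1_pos c a t p (ltW a0) tp; rewrite pa subrr lexx => -> //.
have := @integral_pm1_neg c a p u (ltW a0) pu; rewrite pa subrr lexx => -> //.
by rewrite (ltr0_norm cu) (gtr0_norm ct); lra.
Qed.

Definition slopes_ge0 s := all (fun p => 0 <= p.2) s.

Lemma integral_slope s t u : slopes_ge0 s -> t <= u ->
  mu.-integrable `[t, u] (EFin \o slope s) /\
  \int[mu]_(x in `[t, u]) slope s x = slack s u - slack s t.
Proof.
move=> + tu; elim: s => [|[c a] s IH] /=.
  move=> _; split.
    apply: (@measurable_bounded_integrable _ _ _ mu (cst (-1))) => //.
      by rewrite /= lebesgue_measure_itv; case: ifP; rewrite ?ltry.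
    by exists 1; split => // M M1 x _ /=; rewrite normrN1 ltW.
  by rewrite Rintegral_cst_segment//; lra.
move=> /andP[a0 /IH[int_s sE]]; split.
  exact: (@integrableD _ _ _ mu _ (measurable_itv _) _ _ int_s (integrable_pm1 c a t u)).
rewrite RintegralD//; last exact: integrable_pm1.
by rewrite sE integral_pm1//; lra.
Qed.

Lemma continuous_slack s : continuous (slack s : R -> R^o).
Proof.
elim: s => [|[c a] s IH] /= x.
  by apply: cvgB; [exact: cvg_cst|exact: cvg_id].
apply: cvgB; first exact: IH.
apply: cvg_norm; apply: cvgB; first exact: cvg_cst.
by apply: cvgM; [exact: cvg_id|exact: cvg_cst].
Qed.

Lemma slack_concave s (p t u : R) : 0 <= p <= 1 ->
  (1 - p) * slack s t + p * slack s u <= slack s ((1 - p) * t + p * u).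
Proof.
move=> /andP[p0 p1]; set z := _ * t + _.
have q0 : 0 <= 1 - p by lra.
have := ler_wpM2l q0 (slack_le_slope s z t).
have := ler_wpM2l p0 (slack_le_slope s z u).
have : (1 - p) * (slope s z * (t - z)) + p * (slope s z * (u - z)) = 0.
  by rewrite /z; ring.
by lra.
Qed.

(** The function [x * b + slack s x] is concave with supergradient [slope s x + b], which is
    therefore nonnegative before the maximiser [t1] and nonpositive after it. Its positive part
    integrates to the rise of the function from [e] to [t1]. *)
Lemma integral_pos_slope s b (e t1 t9 : R) :
  slopes_ge0 s -> e <= t1 <= t9 ->
  (forall x, e <= x <= t9 -> x * b + slack s x <= t1 * b + slack s t1) ->
  (\int[mu]_(x in `[e, t9]) (Num.max 0 (slope s x + b))%:E
    = (t1 * b + slack s t1 - (e * b + slack s e))%:E)%E.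
Proof.
move=> s0 /andP[et1 t19] maxt1.
have mslope : measurable_fun setT (slope s) by exact: (@measurable_slope _ _ s id).
have mf : measurable_fun setT (fun x => slope s x + b) by exact: measurable_funD.
have mm : measurable_fun setT (fun x => Num.max 0 (slope s x + b)).
  exact: measurable_maxr.
rewrite (@itv_bndbnd_setU _ _ _ (BRight t1)) ?bnd_simp//.
rewrite ge0_integral_setU//=; last 3 first.
- by apply/measurable_EFinP/measurable_funTS.
- by move=> x _; rewrite lee_fin le_max lexx.
- apply/disj_setPS => x [/=]; rewrite !in_itv/= => /andP[_ xt] /andP[].
  by rewrite ltNge xt.
rewrite [X in (_ + X)%E]integral0_eq ?adde0; last first.
  move=> x /=; rewrite in_itv/= => /andP[t1x xt9]; congr EFin.
  apply/max_idPl.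
  have := slack_le_slope s x t1; have := maxt1 x.
  rewrite xt9 (le_trans et1 (ltW t1x)) => /(_ isT) h1 h2.
  rewrite -(@pmulr_lle0 _ (x - t1)) ?subr_gt0//; lra.
rewrite -integral_itv_bndo_bndc; last by apply/measurable_EFinP/measurable_funTS.
transitivity (\int[mu]_(x in `[e, t1[) (slope s x + b)%:E)%E.
  apply: eq_integral => x; rewrite inE/= in_itv/= => /andP[ex xt1].
  congr EFin; apply/max_idPr.
  have := slack_le_slope s x t1; have := maxt1 x.
  rewrite ex (le_trans (ltW xt1) t19) => /(_ isT) h1 h2.
  rewrite -(@pmulr_lge0 _ (t1 - x)) ?subr_gt0//; lra.
rewrite integral_itv_bndo_bndc; last by apply/measurable_EFinP/measurable_funTS.
have [int_s sE] := integral_slope s0 et1.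
have int_b : mu.-integrable `[e, t1] (EFin \o cst b).
  apply: (@measurable_bounded_integrable _ _ _ mu (cst b)) => //.
    by rewrite /= lebesgue_measure_itv; case: ifP; rewrite ?ltry.
  by exists `|b|; split => // M M1 x _ /=; rewrite ltW.
have int_sb : mu.-integrable `[e, t1] (EFin \o (fun x => slope s x + b)).
  exact: (@integrableD _ _ _ mu _ (measurable_itv _) _ _ int_s int_b).
rewrite -[LHS]fineK; last exact: (@integrable_fin_num _ _ _ mu).
congr EFin; rewrite -/(Rintegral _ _ _) RintegralD// sE Rintegral_cst_segment//.
by lra.
Qed.

(** * One-dimensional sections *)

Definition swept_interval s b : set R :=
  [set x | exists2 t, 0 <= t <= 1 & `|x - t * b| <= slack s t].

Definition slack_dom s : set R := [set t | 0 <= t <= 1 /\ 0 <= slack s t].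

Lemma compact_slack_dom s : compact (slack_dom s).
Proof.
have -> : slack_dom s = `[0, 1]%classic `&` slack s @^-1` [set x | 0 <= x].
  by apply/seteqP; split=> x /=; rewrite in_itv/=.
apply: compact_closedI; first exact: segment_compact.
apply: (closed_comp (f := slack s : R -> R^o)); last exact: closed_ge.
by move=> x _; exact: continuous_slack.
Qed.

Lemma slack_dom_convex s p t u : 0 <= p <= 1 -> slack_dom s t -> slack_dom s u ->
  slack_dom s ((1 - p) * t + p * u).
Proof.
move=> p01 [/andP[t0 t1] gt] [/andP[u0 u1] gu].
have := slack_concave s t u p01; move: p01 => /andP[p0 p1] h.
have q0 : 0 <= 1 - p by lra.
have [t0' u0'] := (mulr_ge0 q0 t0, mulr_ge0 p0 u0).
have := ler_wpM2l q0 t1; have := ler_wpM2l p0 u1 => h1 h2.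
split; first by apply/andP; split; lra.
have := mulr_ge0 q0 gt; have := mulr_ge0 p0 gu; lra.
Qed.

(** There are no gaps: by concavity of [slack], the interval at a time between [t2] and [t1]
    contains the point that divides the two extreme endpoints in the same ratio. *)
Lemma swept_intervalE s b t1 t2 : slack_dom s t1 -> slack_dom s t2 ->
  (forall x, slack_dom s x -> x * b + slack s x <= t1 * b + slack s t1) ->
  (forall x, slack_dom s x -> t2 * b - slack s t2 <= x * b - slack s x) ->
  swept_interval s b = `[t2 * b - slack s t2, t1 * b + slack s t1]%classic.
Proof.
move=> T1 T2 max1 min2.
have [g1 g2] := (T1.2, T2.2).
have LU : t2 * b - slack s t2 <= t1 * b + slack s t1 by have := max1 _ T2; lra.
apply/seteqP; split=> x; rewrite /= in_itv/=.
  case=> t t01; rewrite ler_norml => /andP[h1 h2].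
  have Tt : slack_dom s t by split => //; lra.
  by have := max1 _ Tt; have := min2 _ Tt; move=> ? ?; apply/andP; split; lra.
set L := _ - slack s t2; set U := _ + slack s t1 => /andP[Lx xU].
have [p p01 xE] : exists2 p, 0 <= p <= 1 & x = (1 - p) * L + p * U.
  have [LeU|LneU] := eqVneq L U.
    by exists 0; [lra|move: Lx xU; rewrite -LeU; lra].
  have LU0 : 0 < U - L by rewrite subr_gt0 lt_neqAle LneU.
  exists ((x - L) / (U - L)); last first.
    have : (x - L) / (U - L) * (U - L) = x - L by rewrite mulfVK// gt_eqF.
    by lra.
  by rewrite divr_ge0 ?ler_pdivrMr//; lra.
exists ((1 - p) * t2 + p * t1).
  by have [] := slack_dom_convex p01 T2 T1.
have := slack_concave s t2 t1 p01; move: p01 => /andP[p0 p1] h.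
have := mulr_ge0 p0 g1; have q0 : 0 <= 1 - p by lra.
have := mulr_ge0 q0 g2 => h1 h2.
by rewrite ler_norml xE /L /U; apply/andP; split; lra.
Qed.

(** A section that is nonempty at time 0 starts with its radius there. One that appears later starts
    with radius 0, because a concave function that is negative at 0 and positive at [e] is
    nonnegative at some earlier point. *)
Lemma slack_min_dom s e : slack_dom s e -> (forall x, slack_dom s x -> e <= x) ->
  slack s e = truncpow 1 (slack s 0).
Proof.
move=> Te mine; rewrite /truncpow expr1 divr1.
have [e01 ge] := Te; case: ifPn => [g0|].
  have : e <= 0 by apply: mine; split => //; lra.
  by move=> e0; congr slack; lra.
rewrite -ltNge => g0; apply/eqP; rewrite eq_le ge andbT leNgt; apply/negP => ge0.
have e0 : 0 < e.
  rewrite lt_neqAle; case/andP: e01 => -> _; rewrite andbT; apply/eqP => e0.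
  by move: ge0; rewrite -e0; lra.
pose w := slack s e - slack s 0; have w0 : 0 < w by rewrite /w; lra.
(* [p * e] is the zero of the chord of [slack s] between 0 and [e]. *)
pose p := - slack s 0 / w.
have pw : p * w = - slack s 0 by rewrite /p mulfVK// gt_eqF.
have p0 : 0 <= p by rewrite /p divr_ge0//; lra.
have p1 : p < 1 by rewrite /p ltr_pdivrMr// /w; lra.
have := @slack_concave s p 0 e; rewrite p0 ltW// mulr0 add0r => /(_ isT) h.
have : e <= p * e.
  apply: mine; split; last by move: pw h; rewrite /w; lra.
  case/andP: e01 => _ e1; apply/andP; split; first exact: mulr_ge0 (ltW e0).
  by apply: mulr_ile1 => //; exact: ltW.
by rewrite leNgt gtr_pMl ?p1.
Qed.

(** At the first time [e] the interval has length [2 * slack s e]. The two summands of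
    [signed_pos_sum [:: b]] integrate to the further advance of its right end, for the sign plus,
    and of its left end, for the sign minus. *)
Lemma measure_swept_interval s b : slopes_ge0 s ->
  mu (swept_interval s b) = ((2 * truncpow 1 (slack s 0))%:E
     + \int[mu]_t (sweep [:: b] s 0 t)%:E)%E.
Proof.
move=> s0.
have [T0|/set0P Tne] := eqVneq (slack_dom s) set0.
  have g0 : slack s 0 < 0.
    rewrite ltNge; apply/negP => g0; suff : slack_dom s 0 by rewrite T0.
    by split => //; lra.
  rewrite /truncpow leNgt g0 mulr0 add0e integral0_eq.
    rewrite (_ : swept_interval s b = set0) ?measure0//.
    apply/seteqP; split => x //= [t t01 h]; suff : slack_dom s t by rewrite T0.
    by split => //; exact: le_trans h.
  move=> t _; rewrite /sweep; case: ifPn => // t01.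
  rewrite /truncpow ifN ?mulr0// -ltNge ltNge; apply/negP => gt.
  by suff : slack_dom s t by rewrite T0.
have cT := compact_slack_dom (s := s).
have cid : {within slack_dom s, continuous (id : R -> R)}.
  by apply: continuous_subspaceT => x; exact: cvg_id.
have cb (c : R) : continuous (fun x : R => x * c : R).
  by move=> x; apply: cvgM; [exact: cvg_id|exact: cvg_cst].
have [e /set_mem Te mine] := compact_EVT_min Tne cT cid.
have [t9 /set_mem T9 max9] := compact_EVT_max Tne cT cid.
have ch (c : R) : {within slack_dom s, continuous (fun x : R => x * c + slack s x : R)}.
  by apply: continuous_subspaceT => x; apply: cvgD; [exact: cb|exact: continuous_slack].
have [t1 /set_mem T1 max1] := compact_EVT_max Tne cT (ch b).
have [t2 /set_mem T2 max2] := compact_EVT_max Tne cT (ch (- b)).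
have TE : slack_dom s = `[e, t9]%classic.
  apply/seteqP; split => x /=; rewrite in_itv/=.
    by move=> Tx; rewrite mine ?max9// inE.
  move=> /andP[ex x9]; have [ee|en9] := eqVneq e t9.
    by have -> : x = e by apply/eqP; rewrite eq_le ex ee x9.
  have e9 : 0 < t9 - e by rewrite subr_gt0 lt_neqAle en9 (le_trans ex).
  have p01 : 0 <= (x - e) / (t9 - e) <= 1.
    by rewrite divr_ge0 ?ler_pdivrMr//; lra.
  have := slack_dom_convex p01 Te T9; congr slack_dom.
  by field; rewrite gt_eqF.
have bnd x : slack_dom s x -> e <= x <= t9 by rewrite TE /= in_itv.
have bndT x : e <= x <= t9 -> slack_dom s x by rewrite TE /= in_itv.
rewrite (swept_intervalE T1 T2); last 2 first.
- by move=> x Tx; apply: max1; rewrite inE.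
- by move=> x Tx; have := max2 x; rewrite inE => /(_ Tx); lra.
have -> : (\int[mu]_t (sweep [:: b] s 0 t)%:E = \int[mu]_(t in `[e, t9])
    ((Num.max 0 (slope s t + b))%:E + (Num.max 0 (slope s t + - b))%:E))%E.
  rewrite [RHS]integral_mkcond; apply: eq_integral => t _; rewrite /patch -TE.
  case: ifPn.
    rewrite inE => -[t01 gt]; rewrite /sweep t01 /truncpow gt/= expr0 divr1 mulr1.
    by rewrite EFinD.
  rewrite notin_setE => nT; rewrite /sweep; case: ifPn => // t01.
  rewrite /truncpow ifN ?mulr0//; apply/negP => gt; exact: nT.
have mm c : measurable_fun setT (fun x => Num.max 0 (slope s x + c)).
  apply: measurable_maxr => //; apply: measurable_funD => //.
  exact: (@measurable_slope _ _ s id).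
rewrite ge0_integralD//=; last 4 first.
- by move=> x _; rewrite lee_fin le_max lexx.
- by apply/measurable_EFinP/measurable_funTS; exact: mm.
- by move=> x _; rewrite lee_fin le_max lexx.
- by apply/measurable_EFinP/measurable_funTS; exact: mm.
rewrite (@integral_pos_slope _ _ _ t1)//; last 2 first.
- exact: bnd.
- by move=> x /bndT Tx; apply: max1; rewrite inE.
rewrite (@integral_pos_slope _ _ _ t2)//; last 2 first.
- exact: bnd.
- by move=> x /bndT Tx; apply: max2; rewrite inE.
have ge : slack s e = truncpow 1 (slack s 0).
  by apply: slack_min_dom => // x Tx; apply: mine; rewrite inE.
rewrite [LHS]lebesgue_measure_itv/= lte_fin -ge.
have [h2 h1] := (T2.2, max1 t2); rewrite inE in h1; have {}h1 := h1 T2.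
case: ifPn => h; rewrite -!EFinD; congr EFin; first by lra.
by rewrite -leNgt in h; lra.
Qed.

Lemma measurable_swept_interval s b : measurable (swept_interval s b).
Proof.
apply: is_interval_measurable => x y [t t01 xt] [u u01 yu] z /andP[xz zy].
have [xy|xny] := eqVneq x y.
  by have -> : z = x; [apply/eqP; rewrite eq_le xz xy zy|exists t].
have yx : 0 < y - x by rewrite subr_gt0 lt_neqAle xny (le_trans xz).
pose p := (z - x) / (y - x).
have p01 : 0 <= p <= 1 by rewrite /p divr_ge0 ?ler_pdivrMr//; lra.
have zE : z = (1 - p) * x + p * y.
  by have : p * (y - x) = z - x; [rewrite /p mulfVK// gt_eqF|lra].
have slack0 v w : `|w - v * b| <= slack s v -> 0 <= slack s v by exact: le_trans.
exists ((1 - p) * t + p * u).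
  have Tt : slack_dom s t by split => //; exact: slack0 xt.
  have Tu : slack_dom s u by split => //; exact: slack0 yu.
  by have [] := slack_dom_convex p01 Tt Tu.
apply: le_trans (slack_concave s t u p01).
have -> : z - ((1 - p) * t + p * u) * b = (1 - p) * (x - t * b) + p * (y - u * b).
  by rewrite zE; ring.
move: p01 => /andP[p0 p1]; apply: le_trans (ler_normD _ _) _.
by rewrite lerD// normrM ger0_norm ?ler_wpM2l//; lra.
Qed.

(** * The induction on the number of free coordinates *)

Lemma integral_sweep_cons l s k b t :
  (\int[mu]_y (sweep l ((y, b) :: s) k t)%:E = (sweep (b :: l) s k.+1 t)%:E)%E.
Proof.
rewrite {2}/sweep; case: ifPn => t01; last first.
  by rewrite integral0_eq// => y _; rewrite /sweep ifN.
have mF : measurable_fun setT (fun y : R => (sweep l ((y, b) :: s) k t)%:E).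
  apply/measurable_EFinP.
  by have := measurableT_comp (measurable_sweep_cons l s k b) (measurable_pair2 t); apply.
(* Measured from [t * b], the new coordinate lowers the slack by its absolute value and shifts the
   slope by [b] or [- b] according to its sign. The two half-lines thus yield the two summands of
   [signed_pos_sum (b :: l)]. *)
rewrite -(@ge0_integral_shift _ (t * b) mF); last first.
  by move=> y; rewrite lee_fin sweep_ge0.
rewrite /= -integral_truncpow_pm1 ?signed_pos_sum_ge0//.
apply: eq_integral => u _; congr EFin.
rewrite /sweep t01/= addrK; congr (_ * _).
by rewrite /pm1; case: ifP; rewrite ?mulr1 ?mulrN1.
Qed.

(** The section of the polytope at the coordinates fixed in [s]; [l] holds the entries of the vector
    for the free coordinates. *)
Definition swept_body m (l : m.-tuple R) s : set (m.-tuple R) :=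
  [set x | exists2 t, 0 <= t <= 1 &
     \sum_(i < m) `|tnth x i - t * tnth l i| <= slack s t].

Lemma swept_body_section m (l : m.+1.-tuple R) s y :
  [set x : m.-tuple R | swept_body l s (cons_tuple y x)] =
  swept_body (behead_tuple l) ((y, thead l) :: s).
Proof.
have E (x : m.-tuple R) t :
    \sum_(i < m.+1) `|tnth (cons_tuple y x) i - t * tnth l i| =
    `|y - t * thead l| + \sum_(i < m) `|tnth x i - t * tnth (behead_tuple l) i|.
  rewrite big_ord_recl; congr (_ + _); apply: eq_bigr => i _.
  by rewrite !(tnth_nth 0) /= nth_behead.
apply/seteqP; split=> x /= [t t01 h]; exists t => //; move: h => /=.
  by rewrite E; lra.
by rewrite E; lra.
Qed.

(** The first summand is the volume of the cross-polytope present at time 0, the second what its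
    facets sweep later. *)
Lemma vol_swept_body m (l : m.+1.-tuple R) s : slopes_ge0 s -> all (fun b => 0 <= b) l ->
  vol (swept_body l s) = ((2 ^+ m.+1 * truncpow m.+1 (slack s 0))%:E
     + \int[mu]_t (sweep l s m t)%:E)%E.
Proof.
elim: m l s => [|m IH] l s s0 l0.
  transitivity (\int[mu]_x (\1_(swept_interval s (thead l)) x)%:E)%E.
    apply: eq_integral => x _ /=.
    rewrite indicE.
    have -> : swept_body l s (cons_tuple x [tuple]) = swept_interval s (thead l) x.
      transitivity (swept_body (behead_tuple l) ((x, thead l) :: s) [tuple]).
        by rewrite -swept_body_section.
      apply/propext; split=> -[t t01 h]; exists t => //; move: h.
        by rewrite big_ord0 /=; lra.
      by rewrite big_ord0 /=; lra.
    by case: asboolP => h; [rewrite mem_set|rewrite memNset].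
  rewrite integral_indic ?setIT//; last exact: measurable_swept_interval.
  rewrite [LHS](measure_swept_interval (thead l) s0) expr1.
  suff -> : tval l = [:: thead l] by [].
  by case/tupleP: (l) => b l'; rewrite (tuple0 l') theadE.
transitivity (\int[mu]_y ((2 ^+ m.+1 * truncpow m.+1 (slack s 0 - `|y|))%:E +
   \int[mu]_t (sweep (behead l) ((y, thead l) :: s) m t)%:E))%E.
  apply: eq_integral => y _.
  transitivity (vol (swept_body (behead_tuple l : m.+1.-tuple R) ((y, thead l) :: s))).
    by rewrite -swept_body_section.
  rewrite IH//=.
  - by rewrite mul0r subr0.
  - by apply/andP; split => //; rewrite (tuple_eta l) /= in l0; case/andP: l0.
  - by rewrite (tuple_eta l) /= in l0; case/andP: l0.
have mF := measurable_sweep_cons (behead l) s m (thead l).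
pose F (z : R * R) := (sweep (behead l) ((z.1, thead l) :: s) m z.2)%:E.
have mF' : measurable_fun setT F by apply/measurable_EFinP.
have F0 z : (0 <= F z)%E by rewrite lee_fin sweep_ge0.
rewrite ge0_integralD//=; last 4 first.
- by move=> y _; rewrite lee_fin mulr_ge0 ?exprn_ge0 ?truncpow_ge0.
- apply/measurable_EFinP.
  have mc : measurable_fun setT (fun y : R => slack s 0 - `|y|).
    by apply: measurable_funB => //; exact: measurableT_comp.
  exact: measurable_funM (measurable_cst _) (measurable_truncpow _ mc).
- by move=> y _; apply: integral_ge0 => t _; rewrite lee_fin sweep_ge0.
- exact: (measurable_fun_fubini_tonelli_F (m2 := mu) F mF' F0).
congr (_ + _)%E.
  have := @integral_truncpow_pm1 m.+1 (slack s 0) (2 ^+ m.+1) (2 ^+ m.+1).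
  rewrite exprn_ge0// => /(_ isT isT) h.
  transitivity (((2 ^+ m.+1 + 2 ^+ m.+1) * truncpow m.+2 (slack s 0))%:E)%E.
    by rewrite -h; apply: eq_integral => y _; rewrite if_same.
  by congr (_ * _)%:E; rewrite [in RHS]exprS; lra.
rewrite (fubini_tonelli (m1 := mu) (m2 := mu) F mF' F0) /F /=.
apply: eq_integral => t _; rewrite integral_sweep_cons.
by rewrite [in RHS](tuple_eta l).
Qed.

(** * The polytope as a swept body *)

Lemma convP n (pts : seq (n.-tuple R)) (x : n.-tuple R) :
  Defs.conv pts x <-> exists W : nat -> R,
    [/\ forall k, (k < size pts)%N -> 0 <= W k,
        \sum_(0 <= k < size pts) W k = 1 &
        forall j, tnth x j = \sum_(0 <= k < size pts) W k * tnth (nth x pts k) j].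
Proof.
split=> [[w [w0 [w1 wE]]]|[W [W0 W1 WE]]]; last first.
  exists (fun k => W k); split; first by move=> k; exact: W0.
  by split=> [|j]; [rewrite -W1 big_mkord|rewrite WE big_mkord].
(* Weights indexed by [nat] can be split along a concatenation of lists without casts between
   ordinals. *)
pose W k := if insub k is Some i then w i else 0.
have Ww (k : 'I_(size pts)) : W k = w k by rewrite /W valK.
exists W; split.
- by move=> k kp; rewrite -[k]/(val (Ordinal kp)) Ww.
- by rewrite -w1 big_mkord; apply: eq_bigr => k _; rewrite Ww.
- by move=> j; rewrite wE big_mkord; apply: eq_bigr => k _; rewrite Ww.
Qed.

Definition natr_tuple n (a : n.-tuple nat) : n.-tuple R := map_tuple (fun k => k%:R) a.

Definition generators n (a : n.-tuple nat) : seq (n.-tuple R) :=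
  [seq basis_vec R i | i <- enum 'I_n] ++
  [seq opp_vec (basis_vec R i) | i <- enum 'I_n] ++
  [:: [tuple (tnth a j)%:R | j < n]].

Lemma size_generators n (a : n.-tuple nat) : size (generators a) = (n + (n + 1))%N.
Proof. by rewrite 2!size_cat 2!size_map size_enum_ord. Qed.

Lemma sum_generators n (a : n.-tuple nat) (x : n.-tuple R) (W : nat -> R)
    (F : n.-tuple R -> R) :
  \sum_(0 <= k < size (generators a)) W k * F (nth x (generators a) k) =
  \sum_(i < n) W i * F (basis_vec R i)
  + \sum_(i < n) W (n + i)%N * F (opp_vec (basis_vec R i))
  + W (n + n)%N * F [tuple (tnth a j)%:R | j < n].
Proof.
rewrite size_generators (@big_cat_nat _ _ _ n) ?leq_addr//= -addrA; congr (_ + _).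
  rewrite big_mkord; apply: eq_bigr => i _.
  rewrite nth_cat size_map size_enum_ord ltn_ord (nth_map i) ?size_enum_ord//.
  by rewrite nth_ord_enum.
rewrite (big_addn 0 _ n) addKn big_mkord addn1 big_ord_recr/=; congr (_ + _).
  apply: eq_bigr => i _; rewrite addnC nth_cat size_map size_enum_ord.
  rewrite ltnNge leq_addr/= addKn nth_cat size_map size_enum_ord ltn_ord.
  by rewrite (nth_map i) ?size_enum_ord// nth_ord_enum.
rewrite nth_cat size_map size_enum_ord ltnNge leq_addr/= addKn nth_cat.
by rewrite size_map size_enum_ord ltnn subnn.
Qed.

Lemma sum_basis_vec n (W : nat -> R) (j : 'I_n) :
  \sum_(i < n) W i * tnth (basis_vec R i) j = W j.
Proof.
rewrite (bigD1 j)//= big1 ?addr0 => [|i ij].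
  by rewrite tnth_mktuple eqxx mulr1.
by rewrite tnth_mktuple eq_sym (negbTE ij) mulr0.
Qed.

Lemma sum_opp_basis_vec n (W : nat -> R) (j : 'I_n) :
  \sum_(i < n) W i * tnth (opp_vec (basis_vec R i)) j = - W j.
Proof.
rewrite -[X in - X]sum_basis_vec -sumrN; apply: eq_bigr => i _.
by rewrite !tnth_mktuple mulrN.
Qed.

(** The time [t] is the weight of the vector [a]. The other weights write [x - t a] with total
    weight [1 - t] on the vectors [e_i] and [-e_i], which is possible exactly when its l1 norm is at
    most [1 - t]. *)
Lemma knapsack_dual_polytopeE n (a : n.+1.-tuple nat) :
  @knapsack_dual_polytope R _ a = swept_body (natr_tuple a) [::].
Proof.
have aE j : tnth (natr_tuple a) j = (tnth a j)%:R by rewrite tnth_map.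
set N := n.+1 in a aE *.
apply/seteqP; split=> x.
  move=> /convP[W [W0]]; rewrite -/(generators a) => + WE.
  under eq_bigr do rewrite -[W _]mulr1.
  rewrite (sum_generators a x W (fun=> 1)) mulr1.
  under eq_bigr do rewrite mulr1.
  under [X in _ + X + _]eq_bigr do rewrite mulr1.
  move=> W1.
  have Wp k : (k <= N + N)%N -> 0 <= W k.
    by move=> kN; apply: W0; rewrite -/(generators a) size_generators addnA addn1.
  have S1 : 0 <= \sum_(i < N) W i.
    by apply: sumr_ge0 => i _; rewrite Wp// (leq_trans (ltnW (ltn_ord i)))// leq_addr.
  have S2 : 0 <= \sum_(i < N) W (N + i)%N.
    by apply: sumr_ge0 => i _; rewrite Wp// leq_add2l ltnW.
  have S3 := Wp _ (leqnn _).
  exists (W (N + N)%N); first by apply/andP; split; lra.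
  have : \sum_(i < N) `|tnth x i - W (N + N)%N * tnth (natr_tuple a) i| <=
         \sum_(i < N) (W i + W (N + i)%N).
    apply: ler_sum => i _; rewrite WE.
    rewrite (sum_generators a x W (fun v => tnth v i)) sum_basis_vec.
    rewrite (@sum_opp_basis_vec _ (fun k => W (N + k)%N)) tnth_mktuple aE addrK.
    apply: le_trans (ler_normB _ _) _; rewrite !ger0_norm//; apply: Wp.
      by rewrite leq_add2l ltnW.
    by rewrite (leq_trans (ltnW (ltn_ord i)))// leq_addr.
  by rewrite big_split/=; lra.
case=> t /andP[t0 t1] /= h.
pose u (j : nat) := if insub j is Some i then tnth x i - t * tnth (natr_tuple a) i else 0.
have uE (i : 'I_N) : u i = tnth x i - t * tnth (natr_tuple a) i by rewrite /u valK.
have {}h : \sum_(i < N) `|u i| <= 1 - t.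
  by move: h; congr (_ <= _); apply: eq_bigr => i _; rewrite uE.
(* The weight left over by the positive and negative parts of [u] is spread evenly over all [e_i]
   and [-e_i], where it cancels; this needs a positive dimension. *)
pose kap := (1 - t - \sum_(i < N) `|u i|) / (2 * N%:R).
have kap0 : 0 <= kap by rewrite divr_ge0 ?mulr_ge0 ?ler0n//; lra.
pose W k := if (k < N)%N then (`|u k| + u k) / 2 + kap else
  if (k < N + N)%N then (`|u (k - N)%N| - u (k - N)%N) / 2 + kap else t.
have W1 (i : 'I_N) : W i = (`|u i| + u i) / 2 + kap by rewrite /W ltn_ord.
have W2 (i : 'I_N) : W (N + i)%N = (`|u i| - u i) / 2 + kap.
  by rewrite /W ltnNge leq_addr/= ltn_add2l ltn_ord addKn.
have W3 : W (N + N)%N = t by rewrite /W ltnNge leq_addr/= ltnn.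
apply/convP; exists W; split.
- move=> k _; rewrite /W; case: ifP => _; last case: ifP => // _.
    by have := ler_norm (- u k); rewrite normrN; lra.
  by have := ler_norm (u (k - N)%N); lra.
- rewrite -/(generators a); under eq_bigr do rewrite -[W _]mulr1.
  rewrite (sum_generators a x W (fun=> 1)) mulr1 W3 -big_split/=.
  rewrite (eq_bigr (fun i : 'I_N => `|u i| + 2 * kap)); last first.
    by move=> i _; rewrite !mulr1 W1 W2; lra.
  rewrite big_split/= sumr_const card_ord -mulr_natr /kap.
  have N0 : N%:R != 0 :> R by rewrite pnatr_eq0.
  by field.
- move=> j; rewrite -/(generators a) (sum_generators a x W (fun v => tnth v j)).
  rewrite sum_basis_vec (@sum_opp_basis_vec _ (fun k => W (N + k)%N)) tnth_mktuple.
  by rewrite W1 W2 W3 uE aE; lra.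
Qed.

Lemma integral_sweep_nil l k :
  (\int[mu]_t (sweep l [::] k t)%:E
    = (signed_pos_sum l (-1) * truncpow k.+1 1)%:E)%E.
Proof.
rewrite EFinM -integral_truncpow_pos -ge0_integralZl//; last 3 first.
- apply/measurable_EFinP/measurable_funTS.
  have mc : measurable_fun setT (fun t : R => 1 - t) by exact: measurable_funB.
  exact: measurable_truncpow mc.
- by move=> t _; rewrite lee_fin truncpow_ge0.
- by rewrite lee_fin signed_pos_sum_ge0.
rewrite [RHS]integral_mkcond; apply: eq_integral => t _.
rewrite /patch /sweep/= -EFinM; have [t0|t0] := leP 0 t.
  rewrite mem_set/= ?in_itv/= ?t0//; case: ifPn => //; rewrite -ltNge => t1.
  by rewrite /truncpow ifN ?mulr0// -ltNge; lra.
by rewrite memNset//= in_itv/= leNgt t0.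
Qed.

Theorem vol_knapsack_dual_polytope n (a : n.-tuple nat) :
  vol (@knapsack_dual_polytope R n a) =
  ((2 ^+ n + signed_pos_sum [seq k%:R | k <- a] (-1)) / n`!%:R)%:E.
Proof.
case: n a => [|n] a.
  (* In dimension 0 the only generator is [a] itself, with weight 1. *)
  rewrite /= ifT; last first.
    apply/asboolP; exists (fun=> 1); split=> //; split=> [|[]//].
    rewrite sumr_const card_ord -/(generators a) size_generators.
    by [].
  rewrite (tuple0 a)/= expr0 fact0 divr1 max_l ?addr0// lerN10.
rewrite knapsack_dual_polytopeE vol_swept_body//; last first.
  by apply/allP => _ /mapP[k _ ->]; rewrite ler0n.
rewrite integral_sweep_nil /= subr0 /truncpow ler01 expr1n -EFinD.
by congr EFin; rewrite !mul1r mulrDl.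
Qed.

End Volume.

(** * Rounding error *)

Section Approximation.
Variable K : realFieldType.
Implicit Types (l : seq K) (y z h d : K).

(** A sum over subsets instead of sign vectors: for [y] minus the sum of [l], the second argument of
    the maximum becomes [sigma . l]. All shifts by nonnegative entries go upwards, which suits both
    rounding up and table indices. *)
Fixpoint subset_max l y : K :=
  if l is b :: l' then subset_max l' y + subset_max l' (y + 2 * b)
  else Num.max 1 y.

Lemma subset_maxE l y :
  subset_max l y = 2 ^+ size l + signed_pos_sum l (y + \sum_(b <- l) b - 1).
Proof.
elim: l y => [|b l IH] y /=.
  rewrite big_nil expr0 addr0 [in RHS]addrC addr_maxl add0r subrK.
  by [].
rewrite !IH big_cons exprS.
have -> : y + 2 * b + \sum_(c <- l) c - 1 = y + (b + \sum_(c <- l) c) - 1 + b by lra.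
have -> : y + \sum_(c <- l) c - 1 = y + (b + \sum_(c <- l) c) - 1 - b by lra.
lra.
Qed.

Lemma subset_max_lipschitz l y h : 0 <= h ->
  subset_max l y <= subset_max l (y + h) <= subset_max l y + 2 ^+ size l * h.
Proof.
move=> h0; elim: l y => [|b l IH] y /=.
  rewrite expr0 mul1r.
  by rewrite /Num.max; case: ifPn => h1; case: ifPn => h2;
     rewrite -?leNgt in h1 h2; apply/andP; split; lra.
have /andP[h1 h2] := IH y; have /andP[h3 h4] := IH (y + 2 * b).
rewrite exprS (addrAC y h); apply/andP; split; lra.
Qed.

(** Raising one entry by at most [d] moves an argument by at most [2 * d], and each of the
    [2 ^ size a] terms is 1-Lipschitz. *)
Lemma subset_max_perturb (a : seq nat) (f : nat -> K) d y : 0 <= d ->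
  (forall k, k \in a -> k%:R <= f k <= k%:R + d) ->
  subset_max [seq k%:R | k <- a] y <= subset_max [seq f k | k <- a] y
    <= subset_max [seq k%:R | k <- a] y + 2 ^+ size a * (2 * (size a)%:R * d).
Proof.
move=> d0; elim: a y => [|k a IH] y fk /=.
  by rewrite mulr0 mul0r mulr0 addr0 lexx.
have {}IH z := IH z (fun j ja => fk j (mem_behead (s := k :: a) ja)).
have /andP[fk1 fk2] := fk k (mem_head _ _).
have /andP[h1 h2] := IH y; have /andP[h3 h4] := IH (y + 2 * f k).
have fk0 : 0 <= 2 * (f k - k%:R) by lra.
have := subset_max_lipschitz [seq k%:R | k <- a] (y + 2 * k%:R) fk0.
rewrite (_ : y + 2 * k%:R + 2 * (f k - k%:R) = y + 2 * f k); last by lra.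
move=> /andP[h5 h6]; rewrite size_map in h6; apply/andP; split; first by lra.
have e0 : 0 <= 2 ^+ size a :> K by rewrite exprn_ge0.
have := ler_wpM2l e0 (_ : 2 * (f k - k%:R) <= 2 * d) => /(_ ltac:(lra)) h7.
have := mulr_ge0 e0 d0.
rewrite exprS -natr1; lra.
Qed.

Lemma signed_pos_sum_ge l z : 2 ^+ size l * z <= signed_pos_sum l z.
Proof.
elim: l z => [|b l IH] z /=; first by rewrite mul1r le_max lexx orbT.
have := IH (z + b); have := IH (z - b); rewrite exprS; lra.
Qed.

(** [x] and [- x] collect opposite signs of the entries before [b]. Once [b] is reached, it is taken
    with the sign plus in both sums and the positive parts are bounded below by their arguments; [x]
    cancels and the entries after [b] average out. For [x = 0] both sums coincide. *)
Lemma signed_pos_sum_ge_mem l b x : b \in l ->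
  2 ^+ size l * b <=
  2 * 2 ^+ size l + signed_pos_sum l (x - 1) + signed_pos_sum l (- x - 1).
Proof.
elim: l x => [|c l IH] x //=; rewrite exprS.
have [n1 n2] := (signed_pos_sum_ge0 l (x - 1 - c), signed_pos_sum_ge0 l (- x - 1 - c)).
rewrite inE => /predU1P[->|bl].
  have := signed_pos_sum_ge l (x - 1 + c); have := signed_pos_sum_ge l (- x - 1 + c).
  have : 0 <= 2 ^+ size l :> K by rewrite exprn_ge0.
  lra.
have := IH (x + c) bl; have := IH (x - c) bl.
rewrite (_ : x + c - 1 = x - 1 + c); last by lra.
rewrite (_ : x - c - 1 = x - 1 - c); last by lra.
rewrite (_ : - (x + c) - 1 = - x - 1 - c); last by lra.
rewrite (_ : - (x - c) - 1 = - x - 1 + c); last by lra.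
lra.
Qed.

Lemma signed_pos_sum_ge_sum l :
  2 ^+ size l * \sum_(b <- l) b <=
  2 * (size l)%:R * (2 ^+ size l + signed_pos_sum l (-1)).
Proof.
set G := _ + signed_pos_sum _ _.
have G2 b : b \in l -> 2 ^+ size l * b <= 2 * G.
  by move=> /(@signed_pos_sum_ge_mem _ _ 0); rewrite oppr0 add0r /G; lra.
rewrite mulr_sumr big_seq; apply: le_trans (ler_sum _ G2) _.
rewrite -big_seq big_const_seq count_predT iter_addr_0 -mulr_natr; lra.
Qed.

Lemma subset_max_approx (a : seq nat) (f : nat -> K) (eps : K) :
  let A := \sum_(k <- a) k%:R in
  let d := eps * (A + 1) / (4 * (size a).+1%:R ^+ 2) in
  let G := 2 ^+ size a + signed_pos_sum [seq k%:R | k <- a] (-1) in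
  0 < eps ->
  (forall k, k \in a -> k%:R <= f k <= k%:R + d) ->
  G <= subset_max [seq f k | k <- a] (- A) <= (1 + eps) * G.
Proof.
move=> A d G e0 fk.
have A0 : 0 <= A by apply: sumr_ge0 => k _; rewrite ler0n.
have n0 : 0 < (size a).+1%:R :> K by rewrite ltr0n.
have d0 : 0 <= d by rewrite divr_ge0 ?mulr_ge0 ?exprn_ge0 ?ler0n//; lra.
have := subset_max_perturb (- A) d0 fk.
have -> : subset_max [seq k%:R | k <- a] (- A) = G.
  by rewrite subset_maxE size_map big_map addNr sub0r.
move=> /andP[-> h2] /=; apply: le_trans h2 _; rewrite [leRHS]mulrDl mul1r lerD2l.
have := signed_pos_sum_ge_sum [seq k%:R | k <- a].
rewrite size_map big_map -/A -/G => hA.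
have hG : 2 ^+ size a <= G by rewrite lerDl signed_pos_sum_ge0.
have e2 : 0 <= 2 ^+ size a :> K by rewrite exprn_ge0.
have hAG : 2 ^+ size a * (A + 1) <= 2 * (size a).+1%:R * G by rewrite -natr1; lra.
have dE : d * (4 * (size a).+1%:R ^+ 2) = eps * (A + 1).
  by rewrite /d mulfVK// gt_eqF// mulr_gt0// exprn_gt0.
rewrite -(ler_pM2r (_ : 0 < 2 * (size a).+1%:R :> K)); last by rewrite mulr_gt0.
have h3 := ler_wpM2l (ltW e0) hAG.
apply: le_trans (_ : eps * (2 ^+ size a * (A + 1)) <= _); last by lra.
have -> : eps * (2 ^+ size a * (A + 1)) = 2 ^+ size a * (d * (4 * (size a).+1%:R ^+ 2)).
  by rewrite dE; ring.
rewrite [leLHS](_ : _ = 2 ^+ size a * (d * (size a).+1%:R * 4 * (size a)%:R)); last by ring.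
rewrite [leRHS](_ : _ = 2 ^+ size a * (d * (size a).+1%:R * 4 * (size a).+1%:R)); last by ring.
rewrite ler_wpM2l//.
by rewrite ler_wpM2l ?ler_nat// mulr_ge0// mulr_ge0// ltW.
Qed.
End Approximation.

(** * Structured programs for the RAM *)

Inductive cmd :=
| Blk of seq instr
| Seq of cmd & cmd
| While of nat & cmd
| Ifp of nat & cmd & cmd.

Fixpoint csize (c : cmd) : nat :=
  match c with
  | Blk l => size l
  | Seq c1 c2 => csize c1 + csize c2
  | While _ c => csize c + 3
  | Ifp _ c1 c2 => csize c1 + csize c2 + 2
  end%N.

(** The only test is for positivity: [While] uses it to jump over its exit jump, and [Ifp] places
    the else branch first, on the fall-through path. *)
Fixpoint compile (off : nat) (c : cmd) : seq instr :=
  match c with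
  | Blk l => l
  | Seq c1 c2 => compile off c1 ++ compile (off + csize c1)%N c2
  | While r c => [:: IJpos r (off + 2)%N; IJmp (off + csize c + 3)%N]
      ++ compile (off + 2)%N c ++ [:: IJmp off]
  | Ifp r c1 c2 => [:: IJpos r (off + csize c2 + 2)%N]
      ++ compile (off + 1)%N c2 ++ [:: IJmp (off + csize c1 + csize c2 + 2)%N]
      ++ compile (off + csize c2 + 2)%N c1
  end.

Lemma size_compile off c : size (compile off c) = csize c.
Proof.
elim: c off => [l|c1 IH1 c2 IH2|r c IH|r c1 IH1 c2 IH2] off //=.
- by rewrite size_cat IH1 IH2.
- by rewrite size_cat IH/=; lia.
- by rewrite size_cat/= IH1 IH2; lia.
Qed.

Definition exec_instr (i : instr) (m : memory) : option memory :=
  match i with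
  | IConst d v => Some (upd m d v)
  | IAdd d x y => Some (upd m d (m x + m y))
  | ISub d x y => Some (upd m d (m x - m y))
  | IMul d x y => Some (upd m d (m x * m y))
  | IDiv d x y => if m y == 0 then None else Some (upd m d (m x / m y))
  | ILoad d x => if addr (m x) is Some k then Some (upd m d (m k)) else None
  | IStore d x => if addr (m d) is Some k then Some (upd m k (m x)) else None
  | _ => None
  end.

(** The times count compiled instructions: leaving a loop costs the failed test and the exit jump, a
    round costs the test and the jump back, and the else branch pays for the jump over [c1]. *)
Inductive exec : cmd -> memory -> nat -> memory -> Prop :=
| exec_nil m : exec (Blk [::]) m 0 m
| exec_cons i l m m1 t m' : exec_instr i m = Some m1 ->
    exec (Blk l) m1 t m' -> exec (Blk (i :: l)) m t.+1 m'
| exec_seq c1 c2 m t1 m1 t2 m2 : exec c1 m t1 m1 -> exec c2 m1 t2 m2 ->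
    exec (Seq c1 c2) m (t1 + t2)%N m2
| exec_while_end r c m : ~~ (0 < m r) -> exec (While r c) m 2 m
| exec_while_step r c m t1 m1 t2 m2 : 0 < m r -> exec c m t1 m1 ->
    exec (While r c) m1 t2 m2 -> exec (While r c) m (t1 + 2 + t2)%N m2
| exec_if_pos r c1 c2 m t m' : 0 < m r -> exec c1 m t m' ->
    exec (Ifp r c1 c2) m t.+1 m'
| exec_if_npos r c1 c2 m t m' : ~~ (0 < m r) -> exec c2 m t m' ->
    exec (Ifp r c1 c2) m t.+2 m'.

Fixpoint nsteps (p : seq instr) (t : nat) (c c' : config) : Prop :=
  if t is t'.+1 then exists2 c1, step p c = Some c1 & nsteps p t' c1 c'
  else c = c'.

Lemma nsteps_add p t1 t2 c1 c2 c3 :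
  nsteps p t1 c1 c2 -> nsteps p t2 c2 c3 -> nsteps p (t1 + t2) c1 c3.
Proof.
elim: t1 c1 => [|t1 IH] c1 /=; first by move=> ->.
by move=> [c h1 h2] h3; exists c => //; exact: IH.
Qed.

Lemma nsteps_halts p t c c' : nsteps p t c c' -> fetch p c'.1 = IHalt ->
  halts_in p t c c'.2.
Proof.
elim: t c => [|t IH] c /=; first by move=> ->.
by move=> [c1 h1 h2] h3; exists c1; split=> //; exact: IH.
Qed.

Definition code_at (p : seq instr) off (l : seq instr) :=
  forall i, (i < size l)%N -> fetch p (off + i) = fetch l i.

Lemma code_at_cat p off l1 l2 : code_at p off (l1 ++ l2) <->
  code_at p off l1 /\ code_at p (off + size l1)%N l2.
Proof.
rewrite /code_at /fetch size_cat; split=> [h|[h1 h2] i il].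
  split=> i il; first by rewrite h ?nth_cat ?il//; lia.
  by rewrite -addnA h ?ltn_add2l// nth_cat ltnNge leq_addr addKn.
rewrite nth_cat; case: ltnP => il1; first exact: h1.
by rewrite -h2; [congr nth; lia|lia].
Qed.

Lemma code_at_cons p off i l : code_at p off (i :: l) <->
  fetch p off = i /\ code_at p off.+1 l.
Proof.
rewrite -cat1s code_at_cat addn1; split=> -[h1 h2]; split=> //.
  by have := h1 0%N isT; rewrite addn0.
by case=> // _; rewrite addn0.
Qed.

Lemma step_exec_instr p pc m i m' : fetch p pc = i -> exec_instr i m = Some m' ->
  step p (pc, m) = Some (pc.+1, m').
Proof.
rewrite /step => ->; case: i => //=.
- by move=> ? ? [->].
- by move=> ? ? ? [->].
- by move=> ? ? ? [->].
- by move=> ? ? ? [->].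
- by move=> ? x y; case: ifP => // _ [->].
- by move=> ? x; case: addr => // k [->].
- by move=> d x; case: addr => // k [->].
Qed.

Lemma compile_correct p off c m t m' : exec c m t m' ->
  code_at p off (compile off c) -> nsteps p t (off, m) ((off + csize c)%N, m').
Proof.
move=> h; elim: h off => {c m t m'}.
- by move=> m off _; rewrite addn0.
- move=> i l m m1 t m' h1 _ IH off /code_at_cons[h2 h3] /=.
  exists (off.+1, m1); first exact: step_exec_instr h1.
  by have := IH off.+1 h3; rewrite /= addSnnS.
- move=> c1 c2 m t1 m1 t2 m2 _ IH1 _ IH2 off /= /code_at_cat[h1 h2].
  apply: nsteps_add (IH1 _ h1) _; rewrite size_compile in h2.
  by have := IH2 _ h2; rewrite addnA.
- move=> r c m r0 off /= /code_at_cons[h1 /code_at_cons[h2 _]].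
  exists (off.+1, m); first by rewrite /step h1 (negbTE r0).
  exists ((off + csize c + 3)%N, m); first by rewrite /step h2.
  by rewrite addnA.
- move=> r c m t1 m1 t2 m2 r0 _ IH1 _ IH2 off hc; have := hc.
  move=> /= /code_at_cons[h1 /code_at_cons[_ /code_at_cat[h3 h4]]].
  rewrite (addnC t1) -addnA; exists ((off + 2)%N, m); first by rewrite /step h1 r0.
  rewrite -[X in nsteps _ X]/(1 + (t1 + t2))%N addnCA.
  apply: (@nsteps_add _ _ _ _ ((off + 2 + csize c)%N, m1)).
    by rewrite addn2 in h3 *; exact: IH1.
  rewrite size_compile in h4; have {h4}[h4 _] := (code_at_cons _ _ _ _).1 h4.
  exists (off, m1); last exact: IH2.
  by rewrite /step addn2 h4.
- move=> r c1 c2 m t m' r0 _ IH off /= /code_at_cons[h1 /code_at_cat[_]].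
  rewrite size_compile => /code_at_cons[_ h3].
  exists ((off + csize c2 + 2)%N, m); first by rewrite /step h1 r0.
  have := IH (off + csize c2 + 2)%N; rewrite !addn2 addSn in h3 *.
  by move=> /(_ h3); congr (nsteps _ _ _ (_, _)); lia.
- move=> r c1 c2 m t m' r0 _ IH off /= /code_at_cons[h1 /code_at_cat[h2]].
  rewrite size_compile => /code_at_cons[h3 _].
  exists (off.+1, m); first by rewrite /step h1 (negbTE r0).
  change (nsteps p t.+1 (off.+1, m) ((off + (csize c1 + csize c2 + 2))%N, m')).
  rewrite -[t.+1]addn1.
  rewrite addn1 in h2; apply: nsteps_add (IH _ h2) _.
  exists ((off + csize c1 + csize c2 + 2)%N, m'); first by rewrite /step h3.
  by congr (_, _); lia.
Qed.

(** * A program logic with time bounds *)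

Definition runs (c : cmd) (m : memory) (T : nat) (Q : memory -> Prop) :=
  exists t m', [/\ exec c m t m', (t <= T)%N & Q m'].

Lemma runs_weaken c m T T' (Q Q' : memory -> Prop) :
  runs c m T Q -> (T <= T')%N -> (forall m', Q m' -> Q' m') -> runs c m T' Q'.
Proof.
move=> [t [m' [h tT q]]] TT QQ; exists t, m'; split=> //; last exact: QQ.
exact: leq_trans TT.
Qed.

Lemma runs_seq c1 c2 m T1 T2 Q :
  runs c1 m T1 (fun m1 => runs c2 m1 T2 Q) -> runs (Seq c1 c2) m (T1 + T2) Q.
Proof.
move=> [t1 [m1 [h1 l1 [t2 [m2 [h2 l2 q]]]]]].
exists (t1 + t2)%N, m2; split=> //; [exact: exec_seq h2|exact: leq_add].
Qed.

(** The index of the invariant counts the rounds still to come, so it serves as the variant too. *)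
Lemma runs_while r c m k T (Inv : nat -> memory -> Prop) :
  (forall j m, Inv j.+1 m -> 0 < m r /\ runs c m T (Inv j)) ->
  (forall m, Inv 0%N m -> ~~ (0 < m r)) ->
  Inv k m -> runs (While r c) m (k * (T + 2) + 2) (Inv 0%N).
Proof.
move=> hS h0; elim: k m => [|k IH] m hm.
  by exists 2%N, m; split=> //; apply: exec_while_end; exact: h0.
have [r0 [t1 [m1 [h1 l1 q1]]]] := hS _ _ hm.
have [t2 [m2 [h2 l2 q2]]] := IH _ q1.
exists (t1 + 2 + t2)%N, m2; split=> //; first exact: exec_while_step h2.
by rewrite mulSn; lia.
Qed.

Lemma runs_if r c1 c2 m T Q :
  (0 < m r -> runs c1 m T Q) -> (~~ (0 < m r) -> runs c2 m T Q) ->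
  runs (Ifp r c1 c2) m (T + 2) Q.
Proof.
case: (boolP (0 < m r)) => r0 h1 h2.
  have [t [m' [h l q]]] := h1 isT; exists t.+1, m'; split=> //.
    exact: exec_if_pos.
  by rewrite addn2 ltnS ltnW.
have [t [m' [h l q]]] := h2 isT; exists t.+2, m'; split=> //.
  exact: exec_if_npos.
by rewrite addn2 !ltnS.
Qed.

Lemma addr_nat k : addr k%:R = Some k.
Proof.
rewrite /addr -[k%:R]/((k%:Z)%:~R : rat) numq_int denq_int.
by [].
Qed.

Fixpoint wp (l : seq instr) (Q : memory -> Prop) (m : memory) : Prop :=
  match l with
  | [::] => Q m
  | IConst d v :: l => wp l Q (upd m d v)
  | IAdd d x y :: l => wp l Q (upd m d (m x + m y))
  | ISub d x y :: l => wp l Q (upd m d (m x - m y))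
  | IMul d x y :: l => wp l Q (upd m d (m x * m y))
  | IDiv d x y :: l => m y != 0 /\ wp l Q (upd m d (m x / m y))
  | ILoad d x :: l => exists2 k : nat, m x = k%:R & wp l Q (upd m d (m k))
  | IStore d x :: l => exists2 k : nat, m d = k%:R & wp l Q (upd m k (m x))
  | _ => False
  end.

Lemma runs_blk l m (Q : memory -> Prop) : wp l Q m -> runs (Blk l) m (size l) Q.
Proof.
elim: l m => [|i l IH] m; first by exists 0%N, m; split=> //; exact: exec_nil.
have wk m1 : exec_instr i m = Some m1 -> wp l Q m1 -> runs (Blk (i :: l)) m (size (i :: l)) Q.
  move=> h /IH[t [m' [h1 h2 h3]]]; exists t.+1, m'; split=> //.
  exact: exec_cons h1.
case: i wk => //=.
- by move=> d v; apply.
- by move=> d x y; apply.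
- by move=> d x y; apply.
- by move=> d x y; apply.
- by move=> d x y wk [/negbTE y0]; apply: wk; rewrite y0.
- by move=> d x wk [k xk]; apply: wk; rewrite xk addr_nat.
- by move=> d x wk [k xk]; apply: wk; rewrite xk addr_nat.
Qed.

Lemma updT m d v : upd m d v d = v.
Proof. by rewrite /upd eqxx. Qed.

Lemma updF m d v i : i != d -> upd m d v i = m i.
Proof. by rewrite /upd => /negbTE ->. Qed.

Arguments wp : simpl never.

Section WpRules.
Variables (l : seq instr) (Q : memory -> Prop) (m : memory).
Implicit Types (d x y k : nat) (v : rat).

Lemma wp_IConst d v : wp l Q (upd m d v) -> wp (IConst d v :: l) Q m.
Proof. by []. Qed.

(** The result [v] has a premise of its own, so that it is simplified before it enters the
    memory. *)
Lemma wp_IAdd d x y v : m x + m y = v -> wp l Q (upd m d v) ->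
  wp (IAdd d x y :: l) Q m.
Proof. by move=> <-. Qed.

Lemma wp_ISub d x y v : m x - m y = v -> wp l Q (upd m d v) ->
  wp (ISub d x y :: l) Q m.
Proof. by move=> <-. Qed.

Lemma wp_IMul d x y v : m x * m y = v -> wp l Q (upd m d v) ->
  wp (IMul d x y :: l) Q m.
Proof. by move=> <-. Qed.

Lemma wp_IDiv d x y v : m y != 0 -> m x / m y = v -> wp l Q (upd m d v) ->
  wp (IDiv d x y :: l) Q m.
Proof. by move=> y0 <-. Qed.

Lemma wp_ILoad d x k v : m x = k%:R -> m k = v -> wp l Q (upd m d v) ->
  wp (ILoad d x :: l) Q m.
Proof. by move=> h <-; exists k. Qed.

Lemma wp_IStore d x k v : m d = k%:R -> m x = v -> wp l Q (upd m k v) ->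
  wp (IStore d x :: l) Q m.
Proof. by move=> h <-; exists k. Qed.

End WpRules.

(** Two constant registers differ by computation. That a register differs from an address in the
    arrays mostly follows from [0 < n] alone, so this is tried before [lia] sees the full
    context. *)
Ltac lia_addr := first
  [ exact isT
  | match goal with H : is_true (0 < _)%N |- _ => move: H; clear; lia end
  | lia ].

Ltac upd_simp := repeat first
  [ rewrite updT | rewrite updF; last by lia_addr ].

Ltac wp_ev E := upd_simp; rewrite ?E; reflexivity.

Ltac wp_step E := lazymatch goal with
  | |- wp (IConst _ _ :: _) _ _ => apply: wp_IConst
  | |- wp (IAdd _ _ _ :: _) _ _ => eapply wp_IAdd; [wp_ev E|]
  | |- wp (ISub _ _ _ :: _) _ _ => eapply wp_ISub; [wp_ev E|]
  | |- wp (IMul _ _ _ :: _) _ _ => eapply wp_IMul; [wp_ev E|]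
  | |- wp (IDiv _ _ _ :: _) _ _ => eapply wp_IDiv; [|wp_ev E|]
  end.

Ltac wp_steps E := repeat wp_step E.

Ltac wp_load E a := apply: (@wp_ILoad _ _ _ _ _ a);
  [by upd_simp; rewrite ?E; ring|wp_ev E|].
Ltac wp_store E a := apply: (@wp_IStore _ _ _ _ _ a);
  [by upd_simp; rewrite ?E; ring|wp_ev E|].

Definition save_regs k c :=
  flatten [seq [:: IAdd 0 0 2; IStore 0 j] | j <- iota k c].

Arguments save_regs : simpl never.

(** The bounds [k + c <= 32 <= b] keep the writes clear of the registers still to be read. *)
Lemma wp_save_regs k c b m (Q : memory -> Prop) :
  m 0%N = b%:R -> m 2%N = 1 -> (2 < k)%N -> (k + c <= 32)%N -> (32 <= b)%N ->
  (forall m', m' 0%N = (b + c)%N%:R ->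
     (forall j, (j < c)%N -> m' (b + j.+1)%N = m (k + j)%N) ->
     (forall i, i != 0%N -> ~~ (b < i <= b + c)%N -> m' i = m i) -> Q m') ->
  wp (save_regs k c) Q m.
Proof.
elim: c k b m => [|c IH] k b m m0 m2 k2 kc b32 HQ.
  by apply: HQ => //; rewrite addn0.
change (save_regs k c.+1) with (IAdd 0 0 2 :: IStore 0 k :: save_regs k.+1 c).
have E := (m0, m2).
wp_step E. wp_store E b.+1.
apply: (IH _ b.+1); upd_simp => //; try lia; first by ring.
move=> m' h0 h1 h2; apply: HQ.
- by rewrite h0; congr (_%:R); lia.
- case=> [|j] jc.
    by rewrite h2 ?addn0; [upd_simp; rewrite ?addn1; upd_simp|lia|lia].
  rewrite -addSnnS h1//; upd_simp => //; congr (m _); lia.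
- by move=> i i0 ib; rewrite h2//; [upd_simp|lia].
Qed.

Definition cdiv (x h : rat) : nat := `|Num.ceil (x / h)|%N.

Lemma cdiv_ge x h : 0 <= x -> 0 < h -> x <= (cdiv x h)%:R * h.
Proof.
move=> x0 h0; rewrite -ler_pdivrMr// /cdiv.
have c0 : 0 <= Num.ceil (x / h) by rewrite ceil_ge0 (lt_le_trans (ltrN10 _))// divr_ge0// ltW.
by rewrite natr_absz ger0_norm// ceil_ge.
Qed.

Lemma cdiv_gt x h j : 0 <= x -> 0 < h -> (j < cdiv x h)%N -> j%:R * h < x.
Proof.
move=> x0 h0; rewrite -ltr_pdivlMr// /cdiv => jc.
have c0 : 0 <= Num.ceil (x / h) by rewrite ceil_ge0 (lt_le_trans (ltrN10 _))// divr_ge0// ltW.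
by rewrite -[j%:R]/((j%:Z)%:~R : rat) -ceil_gt_int -(gez0_abs c0) ltz_nat.
Qed.

(** The machine has no rounding operation, so a ceiling is found by counting subtractions until the
    remainder is no longer positive. The time is linear in the quotient. *)
Definition count_steps r q c := While r (Blk [:: ISub r r q; IAdd c c 2]).

Lemma runs_count_steps r q c m x h :
  uniq [:: r; q; c] -> r != 2%N -> c != 2%N ->
  m r = x -> m q = h -> m 2%N = 1 -> m c = 0 -> 0 <= x -> 0 < h ->
  runs (count_steps r q c) m (cdiv x h * 4 + 2)
    (fun m' => m' c = (cdiv x h)%:R /\
               forall i, i != r -> i != c -> m' i = m i).
Proof.
rewrite /= !inE !negb_or andbT => /andP[/andP[rq rc] qc] r2 c2 mr mq m2 mc x0 h0.
pose Inv k m' := exists2 j, (j + k = cdiv x h)%N &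
  [/\ m' r = x - j%:R * h, m' c = j%:R & forall i, i != r -> i != c -> m' i = m i].
apply: (@runs_weaken _ _ (cdiv x h * (2 + 2) + 2) _ (Inv 0%N)) => //; last first.
  by move=> m' [j jk [_ h1 h2]]; split=> //; rewrite h1 -jk addn0.
apply: runs_while.
- move=> k m1 [j jk [h1 h2 h3]]; split.
    by rewrite h1 subr_gt0 cdiv_gt//; lia.
  apply: runs_blk.
  have h4 : m1 q = h by rewrite h3// eq_sym.
  have h5 : m1 2%N = 1 by rewrite h3// eq_sym.
  have E := (h1, h2, h4, h5).
  have cr : c != r by rewrite eq_sym.
  apply: wp_ISub; first reflexivity. apply: wp_IAdd; first reflexivity.
  exists j.+1; first lia; split.
  + by rewrite updF// updT h1 h4; ring.
  + by rewrite updT !updF//; rewrite ?h2 ?h5 1?eq_sym//; ring.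
  + by move=> i ir ic; rewrite !updF// h3.
- move=> m1 [j jk [h1 _ _]]; rewrite h1 -leNgt subr_le0 -[j]addn0 jk.
  exact: cdiv_ge.
- by exists 0%N => //; split=> //; rewrite mul0r subr0.
Qed.

(** * The program *)

Section Program.
Variables (n : nat) (a : n.-tuple nat) (eps : rat).
Hypothesis n_gt0 : (0 < n)%N.
Local Notation ai j := ((nth 0%N a j)%:R : rat).

(* The input occupies the addresses [2 .. n + 1], so that no register is free at
   the start.  The address [32 n] lies beyond the input and can be computed in
   [M[0]] alone; saving [M[2]] there frees a second register, after which
   [M[3 .. 31]] can follow. *)
Definition relocate_regs :=
  Seq (Blk [:: IAdd 0 0 0; IAdd 0 0 0; IAdd 0 0 0; IAdd 0 0 0; IAdd 0 0 0;
               IStore 0 2; IConst 2 1])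
  (Seq (Blk (save_regs 3 29))
  (Blk [:: IConst 4 29%:R; ISub 4 0 4; IConst 3 32%:R; IDiv 3 4 3;
           IConst 5 30%:R; ISub 5 3 5; IConst 6 32%:R; IAdd 7 0 2])).

Record ctx (m : memory) : Prop := Ctx {
  ctx1 : m 1%N = eps; ctx2 : m 2%N = 1; ctx3 : m 3 = n%:R; ctx4 : m 4 = (32 * n)%N%:R }.

Lemma runs_relocate_regs : runs relocate_regs (init_mem a eps) 73
  (fun m => [/\ ctx m, m 5%N = n%:R - 30%:R, m 6%N = 32%:R, m 7%N = (32 * n + 30)%N%:R
    & (forall j, (j < n)%N -> (j < 30)%N -> m (32 * n + j)%N = ai j) /\
      (forall j, (j < n)%N -> (30 <= j)%N -> m (j + 2)%N = ai j)]).
Proof.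
set m0 := init_mem a eps.
have m00 : m0 0%N = n%:R by [].
have m01 : m0 1%N = eps by [].
have m0a j : (j < n)%N -> m0 (j + 2)%N = ai j.
  move=> jn; rewrite /m0 /init_mem addn2 /= subSS subSS subn0 jn.
  by [].
have E := (m00, m01).
apply: (@runs_seq _ _ _ 7 66); apply: runs_blk.
do 5! (wp_step E). wp_store E (32 * n)%N. wp_step E.
apply: (@runs_seq _ _ _ 58 8); apply: runs_blk.
apply: (@wp_save_regs _ _ (32 * n)) => //; try lia.
  by upd_simp; ring.
move=> m h0 h1 h2; apply: runs_blk.
have m32 : m (32 * n)%N = m0 2%N by rewrite h2; [upd_simp|lia|lia].
have m1 : m 1%N = eps by rewrite h2; [upd_simp|lia|lia].
have m2 : m 2%N = 1 by rewrite h2; [upd_simp|lia|lia].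
have {}h1 j : (j.+1 < 30)%N -> m (32 * n + j.+1)%N = m0 (j.+1 + 2)%N.
  by move=> j30; rewrite h1; [upd_simp; congr m0; lia|lia].
have {}h2 i : (31 < i)%N -> (i < 32 * n)%N -> m i = m0 i.
  by move=> i0 i1; rewrite h2; [upd_simp|lia|lia].
have E' := (h0, m1, m2).
do 3! (wp_step E'). wp_step E'; first by upd_simp.
wp_steps E'.
(* The doublings have overwritten [n]; it is recovered from the final pointer as [32 * n / 32]. *)
have e32 : ((32 * n + 29)%N%:R - 29%:R) = (32 * n)%N%:R :> rat by ring.
have en : ((32 * n + 29)%N%:R - 29%:R) / 32%:R = n%:R :> rat by rewrite e32; field.
split.
- by split; upd_simp.
- by upd_simp; rewrite en.
- by upd_simp.
- by upd_simp; ring.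
- split=> j jn j30; upd_simp.
    case: j jn j30 => [|j] jn j30; last by rewrite h1// m0a.
    by rewrite addn0 m32 -(m0a 0%N).
  by rewrite h2 ?m0a//; lia.
Qed.

Definition arr (m : memory) := forall j, (j < n)%N -> m (32 * n + j)%N = ai j.

Definition copy_rest :=
  While 5 (Blk [:: ILoad 8 6; IStore 7 8; IAdd 6 6 2; IAdd 7 7 2; ISub 5 5 2]).

Lemma runs_copy_rest m : ctx m -> m 5%N = n%:R - 30%:R -> m 6%N = 32%:R ->
  m 7%N = (32 * n + 30)%N%:R ->
  (forall j, (j < n)%N -> (j < 30)%N -> m (32 * n + j)%N = ai j) ->
  (forall j, (j < n)%N -> (30 <= j)%N -> m (j + 2)%N = ai j) ->
  runs copy_rest m (n * 7 + 2) (fun m' => ctx m' /\ arr m').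
Proof.
move=> cm m5 m6 m7 ma mb.
(* The subtraction is truncated: for [n <= 30] register 5 is not positive and no round takes
   place. *)
pose r := (n - 30)%N.
pose Inv k m := [/\ ctx m, (k <= r)%N & exists i, [/\ (i + k = r)%N,
  m 5%N = n%:R - (30 + i)%N%:R, m 6%N = (32 + i)%N%:R, m 7%N = (32 * n + 30 + i)%N%:R
    & (forall j, (j < n)%N -> (j < 30 + i)%N -> m (32 * n + j)%N = ai j) /\
      (forall j, (j < n)%N -> (30 <= j)%N -> m (j + 2)%N = ai j)]].
apply: (@runs_weaken _ _ (r * (5 + 2) + 2) _ (Inv 0%N)); last 2 first.
- by rewrite /r; lia.
- move=> m' [cm' _ [i [ir _ _ _ [h _]]]]; split=> // j jn.
  by apply: h => //; rewrite /r in ir; lia.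
apply: runs_while.
- move=> k m1 [[h1 h2 h3 h4] kr [i [ir n5 n6 n7 [na nb]]]].
  rewrite /r in ir kr; split.
    by rewrite n5 subr_gt0 ltr_nat; lia.
  apply: runs_blk.
  have mi : m1 (32 + i)%N = ai (30 + i)%N.
    by rewrite -nb; [congr m1; lia|lia|lia].
  have E := (h1, h2, h3, h4, n5, n6, n7, mi).
  wp_load E (32 + i)%N. wp_store E (32 * n + 30 + i)%N. wp_steps E.
  split; [by split; upd_simp|by rewrite /r; lia|exists i.+1; split].
  + by rewrite /r; lia.
  + by upd_simp; ring.
  + by upd_simp; ring.
  + by upd_simp; ring.
  + split=> j jn ji; last by upd_simp; exact: nb.
    have [->|jne] := eqVneq j (30 + i)%N; first by rewrite addnA; upd_simp.
    by upd_simp; apply: na => //; lia.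
- move=> m1 [_ _ [i [ir -> _ _ _]]]; rewrite -leNgt subr_le0 ler_nat.
  by rewrite /r in ir; lia.
- by split=> //; exists 0%N; split=> //; rewrite ?addn0 //; rewrite /r; lia.
Qed.

Hypothesis eps_gt0 : 0 < eps.

Definition input_sum : rat := \sum_(k <- a) k%:R.
Definition delta : rat := eps * (input_sum + 1) / (4 * n.+1%:R ^+ 2).
(** A bound on every rounded entry in units of [delta] that depends on [n] and [eps] only: each
    entry is below [input_sum + 1], which equals [delta] times [4 (n + 1)^2 / eps]. *)
Definition width : nat := cdiv (4 * n.+1%:R ^+ 2 / eps) 1.
Definition table_size : nat := (n * width).+1.
Definition rnd (k : nat) : rat := delta * (cdiv k%:R delta)%:R.

Lemma input_sum_ge0 : 0 <= input_sum.
Proof. by apply: sumr_ge0 => k _; rewrite ler0n. Qed.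

Lemma delta_gt0 : 0 < delta.
Proof.
have := input_sum_ge0 => A0.
by rewrite divr_gt0// mulr_gt0// ?exprn_gt0//; lra.
Qed.

Lemma nat_le_input_sum k : k \in (a : seq nat) -> k%:R <= input_sum.
Proof.
move=> ka; rewrite /input_sum (big_rem k)//= lerDl.
by apply: sumr_ge0 => j _; rewrite ler0n.
Qed.

Lemma rnd_bounds k : k%:R <= rnd k <= k%:R + delta.
Proof.
have d0 := delta_gt0; rewrite /rnd mulrC cdiv_ge//=.
case E: (cdiv k%:R delta) => [|c]; first by rewrite mul0r addr_ge0// ltW.
have : c%:R * delta < k%:R by apply: cdiv_gt => //; rewrite E.
by rewrite -natr1; lra.
Qed.

Lemma width_bounds :
  4 * n.+1%:R ^+ 2 / eps <= width%:R /\ width%:R < 4 * n.+1%:R ^+ 2 / eps + 1 :> rat.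
Proof.
have x0 : 0 < 4 * n.+1%:R ^+ 2 / eps by rewrite divr_gt0// mulr_gt0// exprn_gt0.
split; first by have := cdiv_ge (ltW x0) ltr01; rewrite mulr1.
rewrite /width; case E: (cdiv _ 1) => [|c]; first by lra.
have : c%:R * 1 < 4 * n.+1%:R ^+ 2 / eps by apply: cdiv_gt; rewrite ?E// ltW.
by rewrite -natr1; lra.
Qed.

Lemma cdiv_le_width k : k \in (a : seq nat) -> (cdiv k%:R delta <= width)%N.
Proof.
move=> ka; rewrite leqNgt; apply/negP => lt_wc.
have := cdiv_gt (ler0n _ k) delta_gt0 lt_wc.
apply/negP; rewrite -leNgt; apply: le_trans (nat_le_input_sum ka) _.
have [h _] := width_bounds.
apply: le_trans (ler_wpM2r (ltW delta_gt0) h).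
have -> : 4 * n.+1%:R ^+ 2 / eps * delta = input_sum + 1.
  have : 4 * n.+1%:R ^+ 2 != 0 :> rat by rewrite gt_eqF// mulr_gt0// exprn_gt0.
  rewrite /delta; move: (4 * _) => D D0.
  by field; rewrite D0 gt_eqF.
by rewrite lerDl.
Qed.

Definition sum_inputs :=
  Seq (Blk [:: IConst 9 0; IAdd 5 3 9; IAdd 6 4 9])
    (While 5 (Blk [:: ILoad 8 6; IAdd 9 9 8; IAdd 6 6 2; ISub 5 5 2])).

Lemma runs_sum_inputs m : ctx m -> arr m ->
  runs sum_inputs m (n * 6 + 5) (fun m' => [/\ ctx m', arr m' & m' 9%N = input_sum]).
Proof.
move=> [c1 c2 c3 c4] ma.
apply: (@runs_weaken _ _ (3 + (n * (4 + 2) + 2))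
  _ _ _ _ _ (fun _ h => h)); last by lia.
have E := (c1, c2, c3, c4).
apply: runs_seq; apply: runs_blk; wp_steps E.
pose Inv k m' := [/\ ctx m', arr m' & exists i, [/\ (i + k = n)%N,
  m' 5%N = k%:R, m' 6%N = (32 * n + i)%N%:R & m' 9%N = \sum_(0 <= j < i) ai j]].
apply: (@runs_weaken _ _ (n * (4 + 2) + 2) _ (Inv 0%N)) => //; last first.
  move=> m' [h1 h2 [i [ik _ _ h9]]]; split=> //; rewrite h9 /input_sum.
  rewrite [RHS](big_nth 0%N) size_tuple; congr (\sum_(0 <= j < _) _).
  by rewrite -ik addn0.
apply: runs_while.
- move=> k m1 [[h1 h2 h3 h4] na [i [ik n5 n6 n9]]].
  split; first by rewrite n5 ltr0n.
  apply: runs_blk.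
  have mi : m1 (32 * n + i)%N = ai i by apply: na; lia.
  have E' := (h1, h2, h3, h4, n5, n6, n9, mi).
  wp_load E' (32 * n + i)%N. wp_steps E'.
  split; first by split; upd_simp.
    by move=> j jn; upd_simp; exact: na.
  exists i.+1; split.
  + lia.
  + by upd_simp; ring.
  + by upd_simp; ring.
  + by upd_simp; rewrite big_nat_recr.
- by move=> m1 [_ _ [i [_ -> _ _]]]; rewrite ltxx.
- split; first by split; upd_simp.
    by move=> j jn; upd_simp; exact: ma.
  exists 0%N; split; first lia.
  + by upd_simp; rewrite addr0.
  + by upd_simp; rewrite addr0 addn0.
  + by upd_simp; rewrite big_geq.
Qed.

Definition set_scale :=
  Seq (Blk [:: IAdd 7 3 2; IMul 7 7 7; IConst 8 4%:R; IMul 7 7 8; IAdd 8 9 2;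
               IMul 8 1 8; IDiv 10 8 7; IDiv 7 7 1; IConst 11 0])
    (count_steps 7 2 11).

Lemma runs_set_scale m : ctx m -> arr m -> m 9%N = input_sum ->
  runs set_scale m (9 + (width * 4 + 2)) (fun m' =>
    [/\ ctx m', arr m', m' 9%N = input_sum, m' 10%N = delta & m' 11%N = width%:R]).
Proof.
move=> [c1 c2 c3 c4] ma m9.
have E := (c1, c2, c3, c4, m9).
have nE : (n%:R + 1) * (n%:R + 1) * 4%:R = 4 * n.+1%:R ^+ 2 :> rat by ring.
have D0 : 4 * n.+1%:R ^+ 2 != 0 :> rat by rewrite gt_eqF// mulr_gt0// exprn_gt0.
apply: runs_seq; apply: runs_blk; do 6! (wp_step E).
wp_step E; first by upd_simp; rewrite nE.
wp_step E; first by upd_simp; rewrite c1 gt_eqF.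
wp_step E.
apply: (@runs_weaken _ _ (width * 4 + 2)); first apply: runs_count_steps => //.
- by upd_simp; rewrite nE.
- by rewrite ltW// divr_gt0// mulr_gt0// exprn_gt0.
- by [].
move=> m' [h1 h2]; split=> //.
- by split; rewrite h2//; upd_simp.
- by move=> j jn; rewrite h2; [upd_simp; exact: ma|lia|lia].
- by rewrite h2//; upd_simp.
- by rewrite h2//; upd_simp; rewrite nE.
Qed.

(* Register 10 holds the rounding unit; the table of the dynamic program starts at
   address [33 n], behind the copied input. *)
Record tctx (m : memory) : Prop := Tctx {
  tctx_ctx : ctx m; tctx_arr : arr m; tctx10 : m 10%N = delta;
  tctx12 : m 12%N = (33 * n)%N%:R; tctx13 : m 13%N = (n * width)%N%:R }.

Definition init_table :=
  Seq (Blk [:: IMul 13 3 11; IAdd 12 4 3; IAdd 5 13 2; IConst 8 0; IAdd 6 12 8;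
               ISub 7 8 9; IAdd 14 10 10])
    (While 5 (Seq (Blk [:: ISub 8 7 2])
             (Seq (Ifp 8 (Blk [:: IStore 6 7]) (Blk [:: IStore 6 2]))
                  (Blk [:: IAdd 7 7 14; IAdd 6 6 2; ISub 5 5 2])))).

Lemma runs_init_table m : ctx m -> arr m -> m 9%N = input_sum -> m 10%N = delta ->
  m 11%N = width%:R ->
  runs init_table m (table_size * 9 + 9) (fun m' => tctx m' /\
    forall s, (s < table_size)%N ->
      m' (33 * n + s)%N = Num.max 1 (2 * delta * s%:R - input_sum)).
Proof.
move=> [c1 c2 c3 c4] ma m9 m10 m11.
apply: (@runs_weaken _ _ (7 + (table_size * ((1 + ((1 + 2) + 3)) + 2) + 2))
  _ _ _ _ _ (fun _ h => h)); last by lia.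
have E := (c1, c2, c3, c4, m9, m10, m11).
apply: runs_seq; apply: runs_blk; wp_steps E.
have e12 : (32 * n)%N%:R + n%:R = (33 * n)%N%:R :> rat by ring.
pose Inv k m' := [/\ tctx m', m' 14%N = delta + delta &
  exists i, [/\ (i + k = table_size)%N,
  m' 5%N = k%:R, m' 6%N = (33 * n + i)%N%:R, m' 7%N = 2 * delta * i%:R - input_sum &
  forall s, (s < i)%N -> m' (33 * n + s)%N = Num.max 1 (2 * delta * s%:R - input_sum)]].
apply: (@runs_weaken _ _ (table_size * ((1 + ((1 + 2) + 3)) + 2) + 2) _ (Inv 0%N)) => //; last first.
  move=> m' [h1 _ [i [ik _ _ _ h]]]; split=> // s st; apply: h; lia.
apply: runs_while.
- move=> k m1 [[[h1 h2 h3 h4] na n10 n12 n13] n14 [i [ik n5 n6 n7 nt]]].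
  split; first by rewrite n5 ltr0n.
  have E' := (h1, h2, h3, h4, n5, n6, n7, n10, n12, n13, n14).
  apply: runs_seq; apply: runs_blk; wp_steps E'.
  apply: runs_seq.
  have [v v1 v2] : exists2 v, v = Num.max 1 (2 * delta * i%:R - input_sum) &
     (runs (Ifp 8 (Blk [:: IStore 6 7]) (Blk [:: IStore 6 2]))
       (upd m1 8 (2 * delta * i%:R - input_sum - 1)) (1 + 2)
       (fun m' => m' = upd (upd m1 8 (2 * delta * i%:R - input_sum - 1)) (33 * n + i)%N v)).
    exists (Num.max 1 (2 * delta * i%:R - input_sum)) => //.
    apply: runs_if; rewrite updT => h; apply: (@runs_blk [:: _]);
      apply: (@wp_IStore _ _ _ _ _ (33 * n + i)%N); try (by upd_simp);
      upd_simp; try reflexivity; congr (upd _ _ _).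
      by rewrite n7 max_r//; lra.
    by rewrite h2 max_l//; rewrite -leNgt in h; lra.
  apply: runs_weaken v2 _ _ => // m2 ->.
  apply: runs_blk; wp_steps E'.
  split.
  + split; first by split; upd_simp.
    * by move=> j jn; upd_simp; exact: na.
    * by upd_simp.
    * by upd_simp.
    * by upd_simp.
  + by upd_simp.
  + exists i.+1; split; first lia.
    * by upd_simp; ring.
    * by upd_simp; ring.
    * by upd_simp; rewrite -natr1; ring.
    * move=> s si; have [->|sne] := eqVneq s i; first by upd_simp.
      by upd_simp; apply: nt; lia.
- by move=> m1 [_ _ [i [_ -> _ _ _]]]; rewrite ltxx.
- split.
  + split; first by split; upd_simp.
    * by move=> j jn; upd_simp; exact: ma.
    * by upd_simp.
    * by upd_simp.
    * by upd_simp; ring.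
  + by upd_simp.
  + exists 0%N; split; first lia.
    * by upd_simp; rewrite /table_size; ring.
    * by upd_simp; rewrite e12 addr0 addn0.
    * by upd_simp; rewrite mulr0.
    * by [].
Qed.

(* The table is updated in place: in ascending order the entry at [s + c] is read
   before it is overwritten. *)
Definition add_shifted :=
  Seq (Blk [:: IAdd 5 13 2; IConst 8 0; IAdd 6 12 8])
    (While 5 (Blk [:: IAdd 8 6 18; ILoad 8 8; ILoad 7 6; IAdd 7 7 8; IStore 6 7;
                      IAdd 6 6 2; ISub 5 5 2])).

Lemma runs_add_shifted m c : tctx m -> m 18%N = c%:R ->
  runs add_shifted m (table_size * 9 + 5) (fun m' => [/\ tctx m', m' 16%N = m 16%N &
    forall s, (s < table_size)%N ->
      m' (33 * n + s)%N = m (33 * n + s)%N + m (33 * n + s + c)%N]).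
Proof.
move=> [[c1 c2 c3 c4] ma m10 m12 m13] m18.
apply: (@runs_weaken _ _ (3 + (table_size * (7 + 2) + 2))
  _ _ _ _ _ (fun _ h => h)); last by lia.
have E := (c1, c2, c3, c4, m10, m12, m13, m18).
apply: runs_seq; apply: runs_blk; wp_steps E.
pose Inv k m' := [/\ tctx m', m' 16%N = m 16%N, m' 18%N = c%:R &
  exists i, [/\ (i + k = table_size)%N,
  m' 5%N = k%:R, m' 6%N = (33 * n + i)%N%:R,
  forall s, (s < i)%N -> m' (33 * n + s)%N = m (33 * n + s)%N + m (33 * n + s + c)%N &
  forall s, (i <= s)%N -> m' (33 * n + s)%N = m (33 * n + s)%N]].
apply: (@runs_weaken _ _ (table_size * (7 + 2) + 2) _ (Inv 0%N)) => //; last first.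
  move=> m' [h1 h2 _ [i [ik _ _ h _]]]; split=> // s st; apply: h; lia.
apply: runs_while.
- move=> k m1 [[[h1 h2 h3 h4] na n10 n12 n13] n16 n18 [i [ik n5 n6 nt nu]]].
  split; first by rewrite n5 ltr0n.
  have ni := nu _ (leqnn i).
  have nic : m1 (33 * n + i + c)%N = m (33 * n + i + c)%N.
    by rewrite -addnA nu// leq_addr.
  have E' := (h1, h2, h3, h4, n5, n6, n10, n12, n13, n18, ni, nic).
  apply: runs_blk; wp_step E'.
  wp_load E' (33 * n + i + c)%N. wp_load E' (33 * n + i)%N. wp_step E'.
  wp_store E' (33 * n + i)%N. wp_steps E'.
  split.
  + split; first by split; upd_simp.
    * by move=> j jn; upd_simp; exact: na.
    * by upd_simp.
    * by upd_simp.
    * by upd_simp.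
  + by upd_simp.
  + by upd_simp.
  + exists i.+1; split; first lia.
    * by upd_simp; ring.
    * by upd_simp; ring.
    * move=> s si; have [->|sne] := eqVneq s i; first by upd_simp.
      by upd_simp; apply: nt; lia.
    * by move=> s si; upd_simp; apply: nu; lia.
- by move=> m1 [_ _ _ [i [_ -> _ _ _]]]; rewrite ltxx.
- split.
  + split; first by split; upd_simp.
    * by move=> j jn; upd_simp; exact: ma.
    * by upd_simp.
    * by upd_simp.
    * by upd_simp.
  + by upd_simp.
  + by upd_simp.
  + exists 0%N; split; first lia.
    * by upd_simp; rewrite /table_size; ring.
    * by upd_simp; rewrite addr0 addn0.
    * by [].
    * by move=> s _; upd_simp.
Qed.

(** Entries are added from the last to the first, so the table after the round for [k] belongs to
    [drop k a]. Cell [s] stands for the argument [2 * delta * s - input_sum], and adding cell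
    [s + c] to it is the recursion of [subset_max] for a rounded entry [delta * c]. *)
Definition item_loop :=
  Seq (Blk [:: IConst 8 0; IAdd 16 3 8])
    (While 16 (Seq (Blk [:: ISub 16 16 2; IAdd 15 4 16; ILoad 17 15; IConst 18 0])
              (Seq (count_steps 17 10 18) add_shifted))).

Definition item_cost := (4 + ((width * 4 + 2) + (table_size * 9 + 5)))%N.

Lemma runs_item_loop m : tctx m ->
  (forall s, (s < table_size)%N ->
     m (33 * n + s)%N = Num.max 1 (2 * delta * s%:R - input_sum)) ->
  runs item_loop m (n * (item_cost + 2) + 4) (fun m' => tctx m' /\
    m' (33 * n)%N = subset_max [seq rnd k | k <- a] (- input_sum)).
Proof.
move=> [[c1 c2 c3 c4] ma m10 m12 m13] mt.
apply: (@runs_weaken _ _ (2 + (n * (item_cost + 2) + 2))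
  _ _ _ _ _ (fun _ h => h)); last by lia.
have E := (c1, c2, c3, c4, m10, m12, m13).
apply: runs_seq; apply: runs_blk; wp_steps E.
(* A round reads up to [width] cells ahead, beyond the end of the table for the last cells, so the
   range of correct cells shrinks by [width] each time. Cell 0 stays correct through all [n]
   rounds. *)
pose Inv k m' := [/\ (k <= n)%N, tctx m', m' 16%N = k%:R &
  forall s, (s <= k * width)%N -> m' (33 * n + s)%N =
    subset_max [seq rnd x | x <- drop k a] (2 * delta * s%:R - input_sum)].
apply: (@runs_weaken _ _ (n * (item_cost + 2) + 2) _ (Inv 0%N)) => //; last first.
  move=> m' [_ h1 _ h]; split=> //; have := h 0%N isT.
  by rewrite addn0 drop0 mulr0 sub0r.
apply: runs_while.
- move=> k m1 [kn [[h1 h2 h3 h4] na n10 n12 n13] n16 nt].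
  split; first by rewrite n16 ltr0n.
  have ki : m1 (32 * n + k)%N = ai k by exact: na.
  have E' := (h1, h2, h3, h4, n10, n12, n13, n16, ki).
  apply: runs_seq; apply: runs_blk; do 2! (wp_step E').
  wp_load E' (32 * n + k)%N. wp_step E'.
  have ka : nth 0%N a k \in (a : seq nat) by rewrite mem_nth// size_tuple.
  apply: runs_seq.
  have cw := cdiv_le_width ka.
  apply: (@runs_weaken _ _ (cdiv (ai k) delta * 4 + 2)).
  + apply: (@runs_count_steps 17 10 18 _ (ai k) delta) => //.
    exact: delta_gt0.
  + by rewrite leq_add2r leq_mul2r cw.
  move=> m2 [n18 fr].
  have t2 : tctx m2.
    split.
    * by split; rewrite fr//; upd_simp.
    * by move=> j jn; rewrite fr; [upd_simp; exact: na|lia|lia].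
    * by rewrite fr//; upd_simp.
    * by rewrite fr//; upd_simp.
    * by rewrite fr//; upd_simp.
  apply: runs_weaken (runs_add_shifted t2 n18) _ _ => // m3 [t3 n16' n3].
  split=> //; first exact: ltnW.
    by rewrite n16' fr//; upd_simp; ring.
  move=> s sk.
  have kw : (k * width <= n * width)%N by rewrite leq_mul2r (ltnW kn) orbT.
  have kw1 : (k.+1 * width <= n * width)%N by rewrite leq_mul2r kn orbT.
  rewrite mulSn in kw1.
  rewrite n3; last by rewrite /table_size ltnS (leq_trans sk).
  rewrite -addnA !fr; try lia; upd_simp.
  rewrite !nt; [|rewrite mulSn; lia..].
  rewrite [in RHS](drop_nth 0%N) ?size_tuple//=; congr (_ + _); congr subset_max.
  by rewrite /rnd natrD; ring.
- by move=> m1 [_ _ -> _]; rewrite ltxx.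
- split=> //.
  + split; first by split; upd_simp.
    * by move=> j jn; upd_simp; exact: ma.
    * by upd_simp.
    * by upd_simp.
    * by upd_simp.
  + by upd_simp; rewrite addr0.
  + move=> s sn; rewrite drop_oversize ?size_tuple//=; upd_simp.
    by apply: mt; rewrite /table_size ltnS.
Qed.

Definition divide_factorial :=
  Seq (Blk [:: ILoad 0 12]) (While 3 (Blk [:: IDiv 0 0 3; ISub 3 3 2])).

Lemma runs_divide_factorial m v : tctx m -> m (33 * n)%N = v ->
  runs divide_factorial m (n * 4 + 3) (fun m' => m' 0%N = v / n`!%:R).
Proof.
move=> [[c1 c2 c3 c4] ma m10 m12 m13] mv.
apply: (@runs_weaken _ _ (1 + (n * (2 + 2) + 2))
  _ _ _ _ _ (fun _ h => h)); last by lia.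
apply: runs_seq; apply: runs_blk; have E := (c1, c2, c3, c4, m12, mv).
wp_load E (33 * n)%N.
pose Inv k (m' : memory) := [/\ m' 2%N = 1, m' 3%N = k%:R & m' 0%N = v * k`!%:R / n`!%:R].
apply: (@runs_weaken _ _ (n * (2 + 2) + 2) _ (Inv 0%N)) => //; last first.
  by move=> m' [_ _ ->]; rewrite mulr1.
apply: runs_while.
- move=> k m1 [h2 h3 h0]; split; first by rewrite h3 ltr0n.
  have E' := (h2, h3, h0).
  apply: runs_blk; wp_step E'; first by rewrite h3 pnatr_eq0.
  wp_steps E'; split.
  + by upd_simp.
  + by upd_simp; ring.
  + upd_simp; rewrite factS natrM.
    have k0 : k.+1%:R != 0 :> rat by rewrite pnatr_eq0.
    have f0 : n`!%:R != 0 :> rat by rewrite pnatr_eq0 -lt0n fact_gt0.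
    move: (k.+1%:R) (k`!%:R) (n`!%:R) k0 f0 => x y z x0 z0.
    by field; rewrite x0 z0.
- by move=> m1 [_ -> _]; rewrite ltxx.
- split; upd_simp => //.
  by rewrite mulfK// pnatr_eq0 -lt0n fact_gt0.
Qed.

End Program.

(** For [n = 0] the address [32 * n] would fall on the registers; the volume is then 1. *)
Definition knapsack_volume :=
  Ifp 0
    (Seq relocate_regs (Seq copy_rest (Seq sum_inputs (Seq set_scale
      (Seq init_table (Seq item_loop divide_factorial))))))
    (Blk [:: IConst 0 1]).

Definition knapsack_volume_cost n eps :=
  ((73 + ((n * 7 + 2) + ((n * 6 + 5) + ((9 + (width n eps * 4 + 2)) +
    ((table_size n eps * 9 + 9) + ((n * (item_cost n eps + 2) + 4) + (n * 4 + 3))))))) + 2)%N.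

Lemma runs_knapsack_volume n (a : n.-tuple nat) (eps : rat) : 0 < eps ->
  runs knapsack_volume (init_mem a eps) (knapsack_volume_cost n eps)
    (fun m => m 0%N = subset_max [seq rnd a eps k | k <- a] (- input_sum a) / n`!%:R).
Proof.
move=> e0; case: n a => [|n] a.
  apply: runs_if => h; first by move: h; rewrite /init_mem /= ltxx.
  have hb : runs (Blk [:: IConst 0 1]) (init_mem a eps) 1 (fun m => m 0%N = 1).
    by apply: (@runs_blk [:: _]); apply: wp_IConst; rewrite /wp updT.
  apply: runs_weaken hb _ _ => // m ->.
  by rewrite (tuple0 a) /input_sum big_nil oppr0 /= max_l// divr1.
have n0 : (0 < n.+1)%N by [].
apply: runs_if => [_|]; last by rewrite /init_mem /= ltr0n.
apply: runs_seq; apply: runs_weaken (runs_relocate_regs a eps n0) _ _ => //.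
move=> m1 [c1 m5 m6 m7 [ma mb]].
apply: runs_seq; apply: runs_weaken (runs_copy_rest n0 c1 m5 m6 m7 ma mb) _ _ => //.
move=> m2 [c2 a2].
apply: runs_seq; apply: runs_weaken (runs_sum_inputs n0 e0 c2 a2) _ _ => //.
move=> m3 [c3 a3 s3].
apply: runs_seq; apply: runs_weaken (runs_set_scale n0 e0 c3 a3 s3) _ _ => //.
move=> m4 [c4 a4 s4 d4 w4].
apply: runs_seq; apply: runs_weaken (runs_init_table n0 e0 c4 a4 s4 d4 w4) _ _ => //.
move=> m5' [c5 t5].
apply: runs_seq; apply: runs_weaken (runs_item_loop n0 e0 c5 t5) _ _ => //.
move=> m6' [c6 v6].
by apply: runs_weaken (runs_divide_factorial n0 e0 c6 v6) _ _.
Qed.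

(** * Running time and the final comparison *)

Lemma expr_bound (x e : rat) : 1 <= x -> 1 <= e -> x ^+ 4 * e <= x ^+ 10 * e ^+ 6.
Proof.
move=> x1 e1; have [x0 e0] := (le_trans ler01 x1, le_trans ler01 e1).
apply: ler_pM => //; first exact: exprn_ge0.
  exact: ler_weXn2l.
by rewrite -[leLHS]expr1; exact: ler_weXn2l.
Qed.

Lemma width_step (x e w : rat) : 1 <= x -> 1 <= e -> w <= 4 * x ^+ 2 * e + 1 ->
  x ^+ 2 * w <= 5 * (x ^+ 4 * e).
Proof.
move=> x1 e1 hw; have x2 : 1 <= x ^+ 2 by rewrite exprn_ege1.
have h : 1 <= x ^+ 2 * e by have := ler_pM ler01 ler01 x2 e1; rewrite mulr1.
have -> : 5 * (x ^+ 4 * e) = x ^+ 2 * (5 * (x ^+ 2 * e)) by ring.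
by rewrite ler_wpM2l ?(le_trans ler01)//; lra.
Qed.

Lemma cost_step (c x y z w : rat) : c <= 165%:R * x -> x <= 5 * y -> y <= z * w ->
  c <= 825%:R * z * w.
Proof. lra. Qed.

Lemma knapsack_volume_cost_le n (eps : rat) : 0 < eps < 1 ->
  (knapsack_volume_cost n eps)%:R <= 825%:R * n.+1%:R ^+ 10 * eps ^- 6 :> rat.
Proof.
move=> /andP[e0 e1].
have [wl wu] := width_bounds n e0; set w := width n eps in wl wu *.
have N1 : 1 <= n.+1%:R :> rat by rewrite ler1n.
have ei : 1 <= eps^-1 by rewrite invf_ge1// ltW.
have w1 : (0 < w)%N.
  rewrite -(ltr_nat rat); apply: lt_le_trans wl.
  by rewrite divr_gt0// mulr_gt0// exprn_gt0.
(* The dominant part is [n] rounds over [n * w + 1] cells; [1 <= w] absorbs the lower-order terms.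
   As [w] is about [4 (n + 1)^2 / eps], the total is of order [(n + 1)^4 / eps]. *)
have costE : (knapsack_volume_cost n eps <= 165 * (n.+1 ^ 2 * w))%N.
  rewrite /knapsack_volume_cost /item_cost /table_size -/w.
  have nw : (n <= n * w)%N by rewrite leq_pmulr.
  have -> : (n * (4 + (w * 4 + 2 + ((n * w).+1 * 9 + 5)) + 2) =
    22 * n + 4 * (n * w) + 9 * (n * (n * w)))%N by lia.
  have -> : (n.+1 ^ 2 * w = n * (n * w) + 2 * (n * w) + w)%N by lia.
  lia.
have c1 : (knapsack_volume_cost n eps)%:R <= 165%:R * (n.+1%:R ^+ 2 * w%:R) :> rat.
  by rewrite -natrX -!natrM ler_nat.
have h1 := width_step N1 ei (ltW wu).
have h2 : n.+1%:R ^+ 4 * eps^-1 <= n.+1%:R ^+ 10 * eps ^- 6.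
  by rewrite -exprVn; exact: expr_bound.
(* The constant 825 is 165 from the step count times 5 from [width_step]. *)
exact: cost_step c1 h1 h2.
Qed.

Lemma ratr_signed_pos_sum (R : realType) (l : seq rat) (z : rat) :
  ratr (signed_pos_sum l z) = signed_pos_sum [seq ratr x | x <- l] (ratr z) :> R.
Proof.
elim: l z => [|b l IH] z /=; last by rewrite rmorphD/= !IH rmorphD rmorphB.
by have [z0|z0] := leP 0 z; [rewrite max_r ?ler0q|rewrite rmorph0 max_l ?lerq0 ?ltW].
Qed.

(* There is a RAM program p and a constant C such that on every input
   (n, a in Z_{>=0}^n, rational eps in (0,1)) it halts after at most
   C * (n+1)^10 * eps^-6 steps with output V = M[0] satisfying
   (1 - eps) Vol(P_a) <= V <= (1 + eps) Vol(P_a). *)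
Theorem theorem1 :
  exists (p : seq instr) (C : nat),
    forall (R : realType) (n : nat) (a : n.-tuple nat) (eps : rat),
      0 < eps < 1 ->
      exists (t : nat) (m : memory),
        halts_in p t (0%N, init_mem a eps) m /\
        (t%:R <= C%:R * (n.+1)%:R ^+ 10 * eps ^- 6 :> rat) /\
        ((1 - ratr eps : R)%:E * vol (@knapsack_dual_polytope R n a)
           <= (ratr (m 0%N) : R)%:E <=
         (1 + ratr eps : R)%:E * vol (@knapsack_dual_polytope R n a))%E.
Proof.
exists (compile 0 knapsack_volume), 825%N => R n a eps e01.
have /andP[e0 e1] := e01.
have [t [m [hexec tT m0]]] := runs_knapsack_volume a e0.
exists t, m; split; last split.
- have := @compile_correct (compile 0 knapsack_volume) 0 _ _ _ _ hexec.
  move=> /(_ (fun i _ => erefl)) h.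
  (* The run ends just past the last instruction, where [fetch] defaults to [IHalt]. *)
  apply: (nsteps_halts h); apply: nth_default; rewrite size_compile.
  exact: leqnn.
- apply: le_trans (knapsack_volume_cost_le n e01).
  by rewrite ler_nat.
pose G : rat := 2 ^+ n + signed_pos_sum [seq k%:R | k <- a] (-1).
(* The volume is rational, so both inequalities can be checked in [rat]. *)
have volE : vol (@knapsack_dual_polytope R n a) = (ratr (G / n`!%:R))%:E.
  rewrite vol_knapsack_dual_polytope rmorphM fmorphV/= ratr_nat rmorphD/= rmorphXn/=.
  rewrite ratr_nat ratr_signed_pos_sum rmorphN1 -map_comp.
  congr ((_ + signed_pos_sum _ _) / _)%:E.
  by apply: eq_map => k /=; rewrite ratr_nat.
have G0 : 0 <= G by rewrite addr_ge0 ?exprn_ge0 ?signed_pos_sum_ge0.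
have f0 : 0 <= n`!%:R^-1 :> rat by rewrite invr_ge0 ler0n.
have := @subset_max_approx _ a (rnd a eps) eps; rewrite /= size_tuple => /(_ e0).
have rb k : k \in (a : seq nat) -> k%:R <= rnd a eps k <= k%:R + delta a eps.
  by move=> _; exact: rnd_bounds.
move=> /(_ rb)/andP[lo hi].
have -> : 1 - ratr eps = ratr (1 - eps) :> R by rewrite rmorphB rmorph1.
have -> : 1 + ratr eps = ratr (1 + eps) :> R by rewrite rmorphD rmorph1.
rewrite volE -!EFinM !lee_fin -!rmorphM/= !ler_rat m0 !mulrA !ler_wpM2r//=.
(* Rounding up never decreases the sum, so the output is at least the true volume, hence at least
   [1 - eps] times it. *)
by apply: le_trans lo; rewrite mulrBl mul1r gerBl mulr_ge0// ltW.
Qed.
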